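(* Let $EP\in e\mathcal{MPGN}4$, i.e. let $EP$ be a non-4-colorable maximal planar graph whose number of vertices is minimum among all non-4-colorable maximal planar graphs. Let $a,b,c,d$ be the four vertices of a diamond in $EP$. Then it is impossible that all of $a,b,c,d$ have degree $5$ in $EP$.
   Context: An MPG is a maximal planar graph, i.e. a simple planar graph embedded in the plane (or sphere) all of whose faces are triangles. A graph is 4-colorable if it admits a proper vertex coloring with 4 colors. The class $e\mathcal{MPGN}4$ consists of all extremum non-4-colorable MPGs: those non-4-colorable MPGs whose number of vertices is minimum among all non-4-colorable MPGs (the class is not assumed a priori to be nonempty or empty; the Four Color Theorem is not presupposed). A diamond in an MPG is the configuration formed by two distinct triangular faces sharing a common edge; its four vertices are the two endpoints of the common edge and the two vertices opposite to that edge. *)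

(* Defs.v *)
(* MathComp *)
From HB Require Import structures.
From mathcomp Require Import all_boot all_fingroup.

Set Implicit Arguments.
Unset Strict Implicit.
Unset Printing Implicit Defensive.

Record sgraph := SGraph {
  vertex :> finType;
  adj : rel vertex;
  adj_sym : symmetric adj;
  adj_irr : irreflexive adj
}.
Arguments adj {G} : rename.

Section SimpleGraph.
Variable G : sgraph.

Definition degree (v : G) : nat := #|[set w | adj v w]|.

Definition colorable (k : nat) : Prop :=
  exists c : G -> 'I_k, forall u v : G, adj u v -> c u != c v.

Definition connected : Prop := forall u v : G, connect adj u v.

Definition edges : {set {set G}} :=
  [set [set p.1; p.2] | p : G * G & adj p.1 p.2].

(* An oriented edge; each edge carries exactly two darts. *)
Definition dart : finType := {p : G * G | adj p.1 p.2}.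

Definition tail (x : dart) : G := (val x).1.
Definition head (x : dart) : G := (val x).2.

Lemma rev_subproof (x : dart) : adj (head x, tail x).1 (head x, tail x).2.
Proof. by rewrite /= adj_sym; exact: (valP x). Qed.

Definition rev (x : dart) : dart := exist _ (head x, tail x) (rev_subproof x).

(* An embedding in an oriented closed surface is encoded by its rotation
   system: [r] sends each dart to the next one leaving the same vertex, and
   it permutes the darts leaving any given vertex in a single cycle. *)
Definition rotation_system (r : {perm dart}) : Prop :=
  forall x y : dart, fconnect r x y <-> tail x = tail y.

Section Faces.
Variable r : {perm dart}.

(* From u -> v to the next dart v -> w on the boundary of the face lying on a
   fixed side of u -> v. *)
Definition face_next (x : dart) : dart := r (rev x).

(* A face is represented by the set of darts on its oriented boundary. *)
Definition face (x : dart) : {set dart} := [set y | fconnect face_next x y].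

Definition faces : {set {set dart}} := [set face x | x : dart].

(* For a connected graph with at least one edge, the surface carrying the
   embedding is the sphere iff V - E + F = 2. *)
Definition spherical : Prop := #|G| + #|faces| = #|edges| + 2.

End Faces.

End SimpleGraph.

Record mpg := MPG {
  mpg_graph :> sgraph;
  mpg_rot : {perm dart mpg_graph};
  mpg_connected : connected mpg_graph;
  mpg_rotation : rotation_system mpg_rot;
  mpg_spherical : spherical mpg_rot;
  (* As the graph is simple, a closed boundary walk of length 3 is a
     triangle. *)
  mpg_triangular : forall f, f \in faces mpg_rot -> #|f| = 3
}.

Definition extremum_non4colorable (M : mpg) : Prop :=
  ~ colorable M 4 /\ (forall M' : mpg, ~ colorable M' 4 -> #|M| <= #|M'|).

(* The faces on the two sides of the edge {tail x, head x} are those of [x]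
   and [rev x]; as they are triangles, the vertex of each opposite to that edge
   is the head of the dart that follows. *)
Definition diamond (M : mpg) (a b c d : M) : Prop :=
  exists x : dart M,
    [/\ face (mpg_rot M) x != face (mpg_rot M) (rev x),
        a = tail x, b = head x,
        c = head (face_next (mpg_rot M) x)
      & d = head (face_next (mpg_rot M) (rev x))].

(* Main.v *)
(* The Birkhoff diamond is D-reducible.  Contracting a suitable edge at one of
   the four vertices gives a smaller simple triangulation, which is 4-colorable
   by minimality; so the graph without the four vertices is 4-colorable.  The
   closed walk of six vertices around the diamond (with possible repetitions)
   can then be recolored by at most five rounds of Kempe switches until its
   coloring extends to the four vertices.

   The topological input is that Kempe chains do not cross.  It is derived
   from the Euler formula by linear algebra over F_2: in a connected spherical
   map every cycle is a sum of face boundaries, so a cycle yields a 2-coloring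
   of the faces that changes exactly across the edges of the cycle. *)

Require Import Defs.
From mathcomp Require Import all_boot all_fingroup all_algebra.
From mathcomp Require Import zify.
(* Restores [head], shadowed by the function on sequences. *)
Import Defs.

Set Implicit Arguments.
Unset Strict Implicit.
Unset Printing Implicit Defensive.

(** * Triangulations described by the third vertex of a face *)

(** This configuration is usually treated in an internally 6-connected triangulation, where the six
    ring vertices are distinct and form a cycle. Separating short cycles are not excluded here. The
    argument is about positions on the closed walk instead: several positions may carry the same
    vertex, and noncrossing is stated for positions and sets of vertices, so coincidences need no
    separate treatment in the recoloring. They matter only when a contraction has to stay simple.

    Since D-reducibility concerns arbitrary colorings outside the diamond, the smaller triangulation
    has to provide just one such coloring; what it does at the contracted edge is irrelevant.

    All faces being triangles, a map is handled through one function, the third vertex of the face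
    along an oriented edge. Links, the contraction and the side of a closed walk on which a face
    lies are all expressed by it. *)

Lemma fconnect_hom (T T' : finType) (f : T -> T) (g : T' -> T') (h : T -> T')
    (A : pred T) :
  (forall x, A x -> A (f x)) ->
  (forall x, A x -> fconnect g (h x) (h (f x))) ->
  forall x y, A x -> fconnect f x y -> fconnect g (h x) (h y).
Proof.
move=> Af gh x y Ax /iter_findex <-; elim: (findex f x y) => [|n IH] //=.
apply: (connect_trans IH); apply: gh.
by elim: n {IH} => //= n; apply: Af.
Qed.

Section RotationFaces.
Variables (G : sgraph) (r : {perm dart G}).

Lemma rev_inv : involutive (@rev G).
Proof. by move=> [[x y] h]; apply: val_inj. Qed.

Lemma face_next_inj : injective (face_next r).
Proof. by move=> x y /perm_inj /(can_inj rev_inv). Qed.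

Lemma card_triangular_faces :
  (forall f, f \in faces r -> #|f| = 3) -> #|faces r| * 3 = #|dart G|.
Proof.
move=> tri; have -> : #|dart G| = #|[set: dart G]| by rewrite cardsT.
apply/esym/card_uniform_partition => //.
have := @equivalence_partitionP _ (fconnect (face_next r)) [set: dart G].
have -> : equivalence_partition (fconnect (face_next r)) [set: dart G] = faces r.
  apply/setP => B; apply/imsetP/imsetP => -[x _ ->]; exists x => //.
    by apply/setP => y; rewrite !inE.
  by apply/setP => y; rewrite !inE.
apply=> x y z _ _ _; split; first exact: connect0.
by move=> h; apply: (same_connect (fconnect_sym face_next_inj)).
Qed.

End RotationFaces.

Section Third.
Variable M : mpg.
Local Notation r := (mpg_rot M).
Local Notation next := (face_next r).

(** With the second argument fixed to [v], this is the rotation at [v]: each neighbour is sent to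
    the next one. With the face orientation fixed, it determines the whole map. The value [x] off
    the edges is arbitrary. *)
Definition third (x y : M) : M :=
  if insub (x, y) is Some d then head (next d) else x.

Lemma thirdE (d : dart M) : third (tail d) (head d) = head (next d).
Proof.
rewrite /third insubT /=; first by case: d => -[].
by move=> H; congr (head (next _)); apply: val_inj; case: d H => -[].
Qed.

Lemma tail_rot (d : dart M) : tail (r d) = tail d.
Proof. by symmetry; apply/(mpg_rotation (m := M)); apply: fconnect1. Qed.

Lemma tail_next (d : dart M) : tail (next d) = head d.
Proof. by rewrite /face_next tail_rot. Qed.

Lemma next_iter3 d : next (next (next d)) = d.
Proof.
have h3 : #|face r d| = 3.
  by apply: (@mpg_triangular M); apply/imsetP; exists d.
have o3 : fingraph.order next d = 3.
  by rewrite /fingraph.order -h3; apply: eq_card => y; rewrite !inE.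
by have := iter_order (@face_next_inj _ r) d; rewrite o3.
Qed.

Lemma third_adj x y : adj x y -> adj y (third x y).
Proof.
move=> h; rewrite -[x]/(tail (exist _ (x, y) h)).
rewrite -[y in third _ y]/(head (exist _ (x, y) h)) thirdE.
rewrite -[y in adj y _]/(head (exist _ (x, y) h)) -tail_next.
exact: (valP (next _)).
Qed.

Lemma third_third x y : adj x y -> third y (third x y) = x.
Proof.
move=> h; set d : dart M := exist _ (x, y) h.
rewrite -[third x y]/(third (tail d) (head d)) thirdE.
by rewrite -[y]/(head d) -tail_next thirdE -tail_next next_iter3.
Qed.

Lemma third_link v x y :
  adj x v -> adj y v -> fconnect (third^~ v) x y.
Proof.
rewrite ![adj _ v]adj_sym => hx hy.
have /(mpg_rotation (m := M)) :
  tail (exist _ (v, x) hx : dart M) = tail (exist _ (v, y) hy : dart M) by [].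
apply: (@fconnect_hom _ _ r (third^~ v) (@head M) [pred d | tail d == v]) => //=.
  by move=> d /eqP <-; rewrite tail_rot.
move=> d /eqP <-.
have -> : r d = next (rev d) by rewrite /face_next rev_inv.
by rewrite -thirdE; apply: fconnect1.
Qed.

End Third.

Lemma card_edges (G : sgraph) : #|edges G| * 2 = #|dart G|.
Proof.
rewrite card_sig -[RHS]sum1_card.
rewrite (partition_big (fun p : G * G => [set p.1; p.2]) (mem (edges G))) /=;
  last by move=> p hp; apply/imsetP; exists p; rewrite ?inE /= in hp *.
rewrite -sum_nat_const; apply: eq_bigr => e /imsetP[[x y]]; rewrite inE /= => h ->.
have nxy : x != y by apply: contraTneq h => ->; rewrite adj_irr.
transitivity #|[set (x, y); (y, x)]|.
  by rewrite cards2 xpair_eqE negb_and nxy.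
rewrite sum1dep_card; apply: eq_card => -[u v]; rewrite !inE /= !xpair_eqE.
apply/orP/andP => [[] /andP[/eqP-> /eqP->]|[_ /eqP E]].
- by [].
- by rewrite adj_sym setUC.
have: u \in [set x; y] by rewrite -E set21.
have: v \in [set x; y] by rewrite -E set22.
have: x \in [set u; v] by rewrite E set21.
have: y \in [set u; v] by rewrite E set22.
rewrite !inE ![u == _]eq_sym ![v == _]eq_sym.
do 4 case/orP=> /eqP ?; subst; rewrite ?eqxx in nxy *; by auto.
Qed.

(** Euler's formula with the faces eliminated by 3F = 2E. In this form it mentions only adjacent
    pairs, so it can be checked for a new triangulation without describing its faces. *)
Lemma card_darts (M : mpg) : #|[set p : M * M | adj p.1 p.2]| + 12 = 6 * #|M|.
Proof.
have <- : #|dart M| = #|[set p : M * M | adj p.1 p.2]|.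
  by rewrite card_sig; apply: eq_card => p; rewrite inE.
have := mpg_spherical M; have := card_triangular_faces (@mpg_triangular M); have := card_edges M.
rewrite /spherical.
move: #|faces _| #|edges _| #|dart _| #|M| => F E D V *; lia.
Qed.

(** * Triangulations built from an adjacency relation and a third-vertex function *)

Section Build.
Variables (T : finType) (P : pred T) (e : rel T) (t : T -> T -> T).
Hypotheses (e_sym : symmetric e) (e_irr : irreflexive e).
Hypothesis eP : forall x y, e x y -> P x.
Hypothesis t_adj : forall x y, e x y -> e y (t x y).
Hypothesis t_third : forall x y, e x y -> t y (t x y) = x.
Hypothesis t_link :
  forall v x y, e x v -> e y v -> fconnect (t^~ v) x y.
Hypothesis e_connected : forall x y, P x -> P y -> connect e x y.
Hypothesis e_card : #|[set p : T * T | e p.1 p.2]| + 12 = 6 * #|P|.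

Let bG : sgraph :=
  @SGraph {x : T | P x} (fun x y => e (val x) (val y))
    (fun x y => e_sym _ _) (fun x => e_irr _).

Let eP2 x y : e x y -> P y. Proof. by rewrite e_sym => /eP. Qed.

Let dart_of x y (h : e x y) : dart bG :=
  exist (fun p : bG * bG => adj p.1 p.2)
    (exist P x (eP h), exist P y (eP2 h)) h.

Let dart_eq (d d' : dart bG) :
  val (tail d) = val (tail d') -> val (head d) = val (head d') -> d = d'.
Proof.
case: d d' => [[x y] h] [[x' y'] h']; rewrite /tail /head /= => /val_inj hx /val_inj hy.
by apply: val_inj; rewrite /= hx hy.
Qed.

Let rot_adj (d : dart bG) : e (val (tail d)) (t (val (head d)) (val (tail d))).
Proof. by apply: t_adj; rewrite e_sym; apply: (valP d). Qed.

Let rot_fun (d : dart bG) : dart bG := dart_of (rot_adj d).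

Let rot_inj : injective rot_fun.
Proof.
move=> d d' E; have ht : val (tail d) = val (tail d') :=
  congr1 (fun x : dart bG => val (tail x)) E.
apply: dart_eq => //.
have hh : t (val (head d)) (val (tail d)) = t (val (head d')) (val (tail d')) :=
  congr1 (fun x : dart bG => val (head x)) E.
have hd (x : dart bG) : val (head x) =
    t (val (tail x)) (t (val (head x)) (val (tail x))).
  by rewrite t_third // e_sym; apply: (valP x).
by rewrite (hd d) (hd d') hh ht.
Qed.

Let rot : {perm dart bG} := perm rot_inj.

Let next_tail d : tail (face_next rot d) = head d.
Proof. by rewrite /face_next permE; apply: val_inj. Qed.

Let next_head d :
  val (head (face_next rot d)) = t (val (tail d)) (val (head d)).
Proof. by rewrite /face_next permE. Qed.

Let rot_system : rotation_system rot.
Proof.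
move=> x y; split.
  move/iter_findex <-; elim: findex => //= n ->.
  by rewrite permE; apply: val_inj.
have hx := valP x; have hy := valP y; rewrite /= -/(tail _) -/(head _) in hx hy.
move=> hxy.
have := t_link (v := val (tail x)) (x := val (head x)) (y := val (head y)).
rewrite ![e _ (val (tail x))]e_sym => /(_ hx); rewrite hxy => /(_ hy).
rewrite -hxy => /iter_findex E.
have it n : val (tail (iter n rot x)) = val (tail x) /\
    val (head (iter n rot x)) = iter n (t^~ (val (tail x))) (val (head x)).
  elim: n => //= n [IHt IHh]; rewrite permE /=; split=> //.
  by rewrite IHt IHh.
set n := findex _ _ _ in E; have [it1 it2] := it n.
have -> : y = iter n rot x.
  apply: dart_eq.
    by rewrite -hxy; apply: esym it1.
  by rewrite -E; apply: esym it2.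
exact: fconnect_iter.
Qed.

Let rot_triangular f : f \in faces rot -> #|f| = 3.
Proof.
case/imsetP=> d _ ->.
have n3 : face_next rot (face_next rot (face_next rot d)) = d.
  have hd : e (val (tail d)) (val (head d)) := valP d.
  have hd1 : e (val (tail (face_next rot d))) (val (head (face_next rot d))).
    exact: valP (face_next rot d).
  rewrite next_tail next_head in hd1.
  apply: dart_eq.
    by rewrite next_tail (next_head (face_next rot d)) next_tail next_head t_third.
  rewrite (next_head (face_next rot (face_next rot d))) next_tail.
  by rewrite (next_head (face_next rot d)) next_tail (next_head d) t_third.
pose p := [:: d; face_next rot d; face_next rot (face_next rot d)].
have Up : uniq p.
  have ne (x : dart bG) : face_next rot x != x.
    apply/eqP => /(congr1 (@tail _)); rewrite next_tail => E.
    by have : e (val (tail x)) (val (head x)) := valP x; rewrite E e_irr.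
  have ne2 : face_next rot (face_next rot d) != d.
    by apply: contra (ne d) => /eqP E; rewrite -{2}n3 E.
  rewrite /p /= !in_cons !in_nil !orbF negb_or.
  by rewrite eq_sym ne eq_sym ne2 eq_sym ne.
have fp : fcycle (face_next rot) p by rewrite /= n3 !eqxx.
have o3 : fingraph.order (face_next rot) d = 3 := order_cycle fp Up (mem_head _ _).
by rewrite -o3; apply: eq_card => y; rewrite !inE.
Qed.

Let card_dart : #|dart bG| = #|[set p : T * T | e p.1 p.2]|.
Proof.
pose h (d : dart bG) := (val (tail d), val (head d)).
rewrite -cardsT -(card_imset (f := h)); last by move=> d d' [] /dart_eq.
apply: eq_card => -[x y]; rewrite inE /=; apply/imsetP/idP => [[d _ [-> ->]]|hxy].
  exact: (valP d).
by exists (dart_of hxy); first exact: in_setT.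
Qed.

Let b_connected : connected bG.
Proof.
move=> [x px] [y py]; have /connectP[s] := e_connected px py.
elim: s x px => [|z s IH] x px /=.
  by move=> _ E; move: py; rewrite E => py; rewrite (bool_irrelevance px py) connect0.
case/andP => hxz pz lz; have pz' := eP2 hxz.
apply: (connect_trans _ (IH z pz' pz lz)).
by apply: connect1.
Qed.

Let b_spherical : spherical rot.
Proof.
have cV : #|bG| = #|P| by rewrite card_sig; apply: eq_card.
have := card_triangular_faces rot_triangular; have := card_edges bG.
rewrite /spherical cV card_dart; move: e_card.
move: #|faces _| #|edges _| #|[set p | _]| #|P| => F E D V *; lia.
Qed.

Lemma build_mpg :
  exists M : mpg, #|M| = #|P| /\
    forall k, colorable M k.+1 ->
      exists c : T -> 'I_k.+1, forall x y, e x y -> c x != c y.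
Proof.
exists (@MPG bG rot b_connected rot_system b_spherical rot_triangular).
split=> [|k [c hc]]; first by rewrite card_sig; apply: eq_card.
(* Vertices outside [P] have no neighbour for [e], so any color does; the successor in [k.+1]
   guarantees that there is one. *)
exists (fun x => if insub x is Some z then c z else ord0) => x y hxy.
rewrite (insubT P (eP hxy)) (insubT P (eP2 hxy)).
exact: hc.
Qed.

End Build.

(** * Cycles and face boundaries *)

Import GRing.Theory.

Section CycleSpace.
Local Open Scope ring_scope.

(** The left kernel lies in the line spanned by the all-ones vector, so it has dimension at most
    1. *)
Lemma rank_constant_kernel (F : fieldType) n m (A : 'M[F]_(n, m)) :
  (forall y : 'rV_n, y *m A = 0 -> forall i j, y 0 i = y 0 j) ->
  (n <= \rank A + 1)%N.
Proof.
move=> H; have : (kermx A <= (const_mx 1 : 'rV[F]_n))%MS.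
  apply/rV_subP => y /sub_kermxP /H yc.
  case: n A H y yc => [|n] A H y yc; first by rewrite thinmx0 sub0mx.
  apply/sub_rVP; exists (y 0 0).
  by apply/rowP => j; rewrite !mxE mulr1.
move/mxrankS; rewrite mxrank_ker => h.
have := rank_leq_row (const_mx 1 : 'rV[F]_n); lia.
Qed.

Lemma addF2 (x : 'F_2) : x + x = 0.
Proof. by apply: addrr_pchar2; rewrite pchar_Fp. Qed.

Lemma addF2_eq0 (x y : 'F_2) : x + y = 0 -> x = y.
Proof. by move=> h; rewrite -[x]addr0 -(addF2 y) addrA h add0r. Qed.

Section CycleBoundary.
Variable M : mpg.
Local Notation r := (mpg_rot M).
Local Notation D := (dart M).

Definition edge_of (d : D) : {set M} := [set tail d; head d].

Lemma dart_ext (d d' : D) : tail d = tail d' -> head d = head d' -> d = d'.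
Proof.
case: d d' => [[x y] h] [[x' y'] h']; rewrite /tail /head /= => hx hy.
by apply: val_inj; rewrite /= hx hy.
Qed.

Lemma tail_head_neq (d : D) : tail d != head d.
Proof.
have : adj (tail d) (head d) := valP d.
by apply: contraTneq => ->; rewrite adj_irr.
Qed.

Lemma edge_of_eq (d d' : D) :
  (edge_of d' == edge_of d) = (d' == d) || (d' == rev d).
Proof.
apply/eqP/orP => [E|[/eqP->|/eqP->] //]; last by rewrite /edge_of setUC.
have: tail d' \in edge_of d by rewrite -E set21.
have: head d' \in edge_of d by rewrite -E set22.
have := tail_head_neq d'; rewrite !inE.
move=> n /orP[] /eqP h /orP[] /eqP t; rewrite t h ?eqxx // in n.
  by right; apply/eqP; apply: dart_ext.
by left; apply/eqP; apply: dart_ext.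
Qed.

Lemma rev_neq (d : D) : rev d != d.
Proof.
apply: contraTneq (tail_head_neq d) => E.
have -> : head d = tail d := congr1 (@tail _) E.
by rewrite eqxx.
Qed.

Lemma edge_of_in (d : D) : edge_of d \in edges M.
Proof.
by apply/imsetP; exists (tail d, head d); rewrite ?inE //; apply: (valP d).
Qed.

Lemma face_in (d : D) : face r d \in faces r.
Proof. exact: imset_f. Qed.

Let ei (d : D) : 'I_#|edges M| := enum_rank_in (edge_of_in d) (edge_of d).
Let fi (d : D) : 'I_#|faces r| := enum_rank_in (face_in d) (face r d).
Let vi (v : M) : 'I_#|M| := enum_rank v.

Let ei_eq d d' : (ei d' == ei d) = (d' == d) || (d' == rev d).
Proof.
rewrite -edge_of_eq -(inj_eq enum_val_inj) !enum_rankK_in //; exact: edge_of_in.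
Qed.

Let fi_onto i : exists d, i = fi d.
Proof.
have /imsetP[d h Ej] := enum_valP i.
by exists d; apply: enum_val_inj; rewrite enum_rankK_in ?face_in.
Qed.

Lemma face_next_face d : face r (face_next r d) = face r d.
Proof.
apply/setP=> y; rewrite !inE.
apply/esym/(same_connect (fconnect_sym (@face_next_inj _ r))).
exact: fconnect1.
Qed.

Let fi_next d : fi (face_next r d) = fi d.
Proof.
by apply: enum_val_inj; rewrite !enum_rankK_in ?face_in // face_next_face.
Qed.

Let fi_rot d : fi (r d) = fi (rev d).
Proof. by rewrite -(fi_next (rev d)) /face_next rev_inv. Qed.

Let sum_edge (g : D -> 'F_2) d :
  \sum_d' (ei d' == ei d)%:R * g d' = g d + g (rev d).
Proof.
rewrite (bigD1 d) //= (bigD1 (rev d)) ?rev_neq //= big1 => [|d' /andP[n1 n2]].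
  by rewrite !ei_eq !eqxx orbT !mul1r addr0.
by rewrite ei_eq (negPf n1) (negPf n2) mul0r.
Qed.

(** Incidence matrices modulo 2, edge by vertex and face by edge. They are written as sums over
    darts because the two darts of an edge start at its two ends and lie on its two sides. *)
Let A : 'M['F_2]_(#|edges M|, #|M|) :=
  \matrix_(j, k) \sum_d (ei d == j)%:R * (vi (tail d) == k)%:R.
Let B : 'M['F_2]_(#|faces r|, #|edges M|) :=
  \matrix_(i, j) \sum_d (ei d == j)%:R * (fi d == i)%:R.

Let sum_delta n (x : 'I_n -> 'F_2) k : \sum_i x i * (k == i)%:R = x k.
Proof.
rewrite (bigD1 k) //= eqxx mulr1 big1 ?addr0 // => i /negPf.
by rewrite eq_sym => ->; rewrite mulr0.
Qed.

Let mulA (y : 'rV_#|M|) d :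
  (y *m A^T) 0 (ei d) = y 0 (vi (tail d)) + y 0 (vi (head d)).
Proof.
rewrite mxE -[RHS](sum_edge (fun d => y 0 (vi (tail d)))).
under eq_bigr => i _ do rewrite !mxE mulr_sumr.
rewrite exchange_big; apply: eq_bigr => d' _ /=.
by under eq_bigr => i _ do rewrite mulrCA; rewrite -mulr_sumr sum_delta.
Qed.

Let mulB (y : 'rV_#|faces r|) d :
  (y *m B) 0 (ei d) = y 0 (fi d) + y 0 (fi (rev d)).
Proof.
rewrite mxE -[RHS](sum_edge (fun d => y 0 (fi d))).
under eq_bigr => i _ do rewrite !mxE mulr_sumr.
rewrite exchange_big; apply: eq_bigr => d' _ /=.
by under eq_bigr => i _ do rewrite mulrCA; rewrite -mulr_sumr sum_delta.
Qed.

Let mulcA (y : 'rV_#|edges M|) k :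
  (y *m A) 0 k = \sum_(d | vi (tail d) == k) y 0 (ei d).
Proof.
rewrite mxE; under eq_bigr => i _ do rewrite !mxE mulr_sumr.
rewrite exchange_big [RHS]big_mkcond; apply: eq_bigr => d' _ /=.
under eq_bigr => i _ do rewrite mulrA; rewrite -mulr_suml sum_delta.
by case: eqP => _; rewrite ?mulr1 ?mulr0.
Qed.

Let BA : B *m A = 0.
Proof.
apply/row_matrixP => i; rewrite row0; apply/rowP => k.
rewrite row_mul mulcA [RHS]mxE.
transitivity (\sum_(d | vi (tail d) == k)
                ((fi d == i)%:R + (fi (rev d) == i)%:R : 'F_2)).
  apply: eq_bigr => d _; rewrite !mxE.
  exact: (sum_edge (fun d => (fi d == i)%:R)).
(* Turning around the vertex carries the face of [r d] to that of [rev d], so the two halves of the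
   sum agree and cancel modulo 2. *)
rewrite big_split /= (reindex_inj (@perm_inj _ r)) /=.
under eq_bigl => d do rewrite tail_rot.
by under eq_bigr => d _ do rewrite fi_rot; rewrite addF2.
Qed.

(** Rotation reaches every dart at a vertex and reversal passes to a neighbour. For a function that
    depends only on the face of a dart, this is connectivity of the dual graph. *)
Lemma dart_constant (T : Type) (g : D -> T) :
  (forall d, g (rev d) = g d) -> (forall d, g (r d) = g d) ->
  forall d d', g d = g d'.
Proof.
move=> grev grot.
have gt d d' : tail d = tail d' -> g d = g d'.
  move/(mpg_rotation (m := M))/iter_findex <-.
  by elim: findex => //= n ->.
move=> d d'; have /connectP[s] := mpg_connected (tail d) (tail d').
elim: s d => [|z s IH] d /=; first by move=> _ /esym/gt.
case/andP=> h hs E; pose x : D := exist _ (tail d, z) h.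
by rewrite (gt d x) // -grev; apply: IH.
Qed.

(* Both incidence matrices have corank at most 1 by connectivity, so by Euler's
   formula the face boundaries, which lie in the cycle space, fill it. *)
Lemma cycle_boundary (c : D -> 'F_2) :
  (forall d, c (rev d) = c d) ->
  (forall v, \sum_(d | tail d == v) c d = 0) ->
  exists z : {set D} -> 'F_2,
    forall d, c d = z (face r d) + z (face r (rev d)).
Proof.
move=> crev cyc.
have rA : (#|M| <= \rank A + 1)%N.
  rewrite -mxrank_tr; apply: rank_constant_kernel => y yA i j.
  have yadj u v : adj u v -> y 0 (vi u) = y 0 (vi v).
    move=> h; apply: addF2_eq0.
    by rewrite -(mulA y (exist _ (u, v) h)) yA mxE.
  rewrite -(enum_valK i) -(enum_valK j).
  have /connectP[s] := mpg_connected (enum_val i) (enum_val j).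
  elim: s (enum_val i) => [|z s IH] x /=; first by move=> _ ->.
  by case/andP=> /yadj -> /IH h /h.
have rB : (#|faces r| <= \rank B + 1)%N.
  apply: rank_constant_kernel => y yB i j.
  have [[d ->] [d' ->]] := (fi_onto i, fi_onto j).
  have yr d0 : y 0 (fi (rev d0)) = y 0 (fi d0).
    by apply/esym/addF2_eq0; rewrite -mulB yB mxE.
  apply: (dart_constant (g := fun d => y 0 (fi d))) => // d0.
  by rewrite fi_rot yr.
have BkA : (B <= kermx A)%MS by apply/sub_kermxP.
(* The cycle space has dimension at most E - V + 1 = F - 1, which is at most the rank of [B]. *)
have kAB : (kermx A <= B)%MS.
  rewrite -(geq_leqif (mxrank_leqif_sup BkA)) mxrank_ker.
  have := mpg_spherical M; rewrite /spherical; lia.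
pose y : 'rV_#|edges M| := \row_j (if [pick d | ei d == j] is Some d then c d else 0).
have yE d : y 0 (ei d) = c d.
  rewrite mxE; case: pickP => [d'|/(_ d)]; last by rewrite eqxx.
  by rewrite ei_eq => /orP[] /eqP ->.
have /sub_kermxP yA : (y <= kermx A)%MS.
  apply/sub_kermxP/rowP => k; rewrite mulcA [RHS]mxE.
  rewrite -[RHS](cyc (enum_val k)); apply: eq_big => [d|d _]; last exact: yE.
  by rewrite -(inj_eq enum_rank_inj) enum_valK.
have /submxP[z yz] := submx_trans (introT sub_kermxP yA) kAB.
exists (fun f => if [pick d | face r d == f] is Some d then z 0 (fi d) else 0).
have zE d : (if [pick d' | face r d' == face r d] is Some d' then z 0 (fi d') else 0)
    = z 0 (fi d).
  case: pickP => [d' /eqP E|/(_ d)]; last by rewrite eqxx.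
  by congr (z 0 _); apply: enum_val_inj; rewrite !enum_rankK_in ?face_in.
by move=> d; rewrite !zE -mulB -yz yE.
Qed.

End CycleBoundary.

End CycleSpace.

(** * Closed walks as chains modulo 2 and the faces they enclose *)

Definition within (M : mpg) (S : {set M}) : rel M :=
  [rel x y | [&& x \in S, y \in S & adj x y]].

Section Potential.
Variable M : mpg.
Local Notation D := (dart M).
Local Open Scope ring_scope.

Definition edge_chain (x d : D) : 'F_2 := (d == x)%:R + (d == rev x)%:R.

Lemma edge_chain_rev x d : edge_chain x (rev d) = edge_chain x d.
Proof.
by rewrite /edge_chain (inj_eq (can_inj (@rev_inv M))) (can2_eq (@rev_inv M) (@rev_inv M)) addrC.
Qed.

Lemma edge_chain_boundary x v :
  \sum_(d : D | tail d == v) edge_chain x d = (tail x == v)%:R + (head x == v)%:R.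
Proof.
have one (y : D) : \sum_(d : D | tail d == v) (d == y)%:R = (tail y == v)%:R :> 'F_2.
  rewrite big_mkcond (bigD1 y) //= big1 ?addr0 => [|d /negPf->]; last by case: ifP.
  by rewrite eqxx; case: eqP.
by rewrite big_split /= !one.
Qed.

(** The chain counts modulo 2 how often a walk inside [S] uses each edge; the contributions of inner
    vertices cancel and only the two ends remain in the boundary. *)
Lemma within_chain (S : {set M}) u v :
  connect (within S) u v ->
  exists c : D -> 'F_2,
    [/\ forall d, c (rev d) = c d,
        forall d, ~~ ((tail d \in S) && (head d \in S)) -> c d = 0
      & forall w, \sum_(d | tail d == w) c d = (u == w)%:R + (v == w)%:R].
Proof.
case/connectP=> s; elim: s u => [|z s IH] u /=.
  move=> _ ->; exists (fun=> 0); split=> // w.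
  by rewrite big1 // addF2.
case/andP=> /and3P[uS zS uz] /IH h /h [c [crev cS cb]].
pose x : D := exist _ (u, z) uz.
exists (fun d => edge_chain x d + c d); split=> [d|d nS|w].
- by rewrite edge_chain_rev crev.
- rewrite cS // addr0 /edge_chain.
  do 2![case: eqP nS => [->|_ nS]; first by rewrite uS zS].
  by rewrite addr0.
- by rewrite big_split /= cb edge_chain_boundary addrA -(addrA (u == w)%:R) addF2 addr0.
Qed.

Lemma F2_addb (x y : 'F_2) : (x + y != 0) = (x != 0) (+) (y != 0).
Proof. by case: x y => [[|[|//]] ?] [[|[|//]] ?]. Qed.

(* A closed walk through S and H with exactly two edges between them bounds a
   set of faces; [f x y] tells whether the face left of [x -> y] is in it. *)
Lemma cut_potential (S H : {set M}) (x1 x2 : D) :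
  [disjoint S & H] ->
  tail x1 \in H -> head x1 \in S -> tail x2 \in H -> head x2 \in S ->
  x1 != x2 ->
  connect (within H) (tail x1) (tail x2) ->
  connect (within S) (head x1) (head x2) ->
  exists f : M -> M -> bool,
    [/\ forall x y, adj x y -> f x y = f y (third x y),
        forall d : D, tail d \in H -> head d \notin H ->
          f (head d) (tail d) =
            f (tail d) (head d) (+) ((d == x1) || (d == x2))
      & forall x y, adj x y -> x \notin S :|: H -> f x y = f y x].
Proof.
move=> SH H1 S1 H2 S2 n12 /within_chain[cH [revH suppH bH]] /within_chain[cS [revS suppS bS]].
have SnH x : x \in S -> x \notin H by move=> /(disjointFr SH) ->.
have HnS x : x \in H -> x \notin S by move=> /(disjointFl SH) ->.
pose c d := cH d + cS d + edge_chain x1 d + edge_chain x2 d.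
have [d|v|z cz] := @cycle_boundary M c.
- by rewrite /c revH revS !edge_chain_rev.
- rewrite /c 3!big_split /= bH bS !edge_chain_boundary.
  by do 4!case: (_ == v); apply/eqP.
pose f x y := if insub (x, y) is Some d then z (face (mpg_rot M) d) != 0 else false.
have fE d : f (tail d) (head d) = (z (face (mpg_rot M) d) != 0).
  rewrite /f insubT /=; first by case: d => -[].
  move=> h; congr (z (face _ _) != 0); exact: dart_ext.
have fx d : f (head d) (tail d) = f (tail d) (head d) (+) (c d != 0).
  rewrite fE -[head d]/(tail (rev d)) -[tail d in LHS]/(head (rev d)) fE cz F2_addb.
  by rewrite addbA addbb.
exists f; split.
- move=> x y h; pose d : D := exist _ (x, y) h.
  rewrite -[x]/(tail d) -[y]/(head d) thirdE -[head d in RHS]tail_next !fE.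
  by rewrite face_next_face.
- move=> d dH dS; rewrite fx; congr (_ (+) _).
  rewrite /c suppH ?(negPf dS) ?andbF // suppS ?(negPf (HnS _ dH)) // !add0r.
  have nrev x : head x \in S -> (d == rev x) = false.
    by move=> xS; apply: contraTF dH => /eqP ->; apply: SnH.
  rewrite /edge_chain !nrev // !addr0.
  by case: (d =P x1) => [->|_]; [rewrite (negPf n12) | case: (d =P x2)].
- move=> x y h; rewrite in_setU negb_or => /andP[xS xH].
  pose d : D := exist _ (x, y) h.
  rewrite -[y]/(head d) -[x]/(tail d) fx.
  rewrite /c suppH /= ?(negPf xH) // suppS ?(negPf xS) // !add0r.
  have n y' : tail y' \in H -> head y' \in S -> edge_chain y' d = 0.
    move=> hH hS; rewrite /edge_chain.
    case: (d =P y') => [E|_]; first by rewrite -E /= (negPf xH) in hH.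
    case: (d =P _) => [E|_]; last by rewrite addr0.
    by rewrite -[head y']/(tail (rev y')) -E /= (negPf xS) in hS.
  by rewrite !n // addr0 eqxx addbF.
Qed.

End Potential.

Section Away.
Variables (M : mpg) (f : M -> M -> bool) (K : {set M}).
Hypothesis f_face : forall x y, adj x y -> f x y = f y (third x y).
Hypothesis f_away : forall x y, adj x y -> x \in K -> f x y = f y x.

(** Passing from one face around [x] to the next crosses an edge at [x], and no edge at a vertex of
    [K] changes the potential. *)
Lemma potential_around x y z : x \in K -> adj x y -> adj x z -> f x y = f x z.
Proof.
move=> xK; rewrite ![adj x _]adj_sym => hy hz.
have := third_link hy hz => /iter_findex <-.
set n := findex _ _ _; pose it n := iter n ((@third M)^~ x) y.
suff: adj (it n) x /\ f x y = f x (it n) by case.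
elim: n => //= n [h ->]; split; first by rewrite adj_sym third_adj.
by rewrite f_away // 1?adj_sym // f_face.
Qed.

Lemma potential_along x y x' y' :
  connect (within K) x y -> x \in K -> adj x x' -> adj y y' -> f x x' = f y y'.
Proof.
case/connectP=> s; elim: s x x' => [|z s IH] x x' /=.
  by move=> _ -> xK h h'; apply: potential_around.
case/andP=> /and3P[_ zK xz] hs l xK h h'.
rewrite (potential_around xK h xz) f_away //.
by apply: IH => //; rewrite adj_sym.
Qed.

End Away.

(** The rotation at a vertex of degree 5, read from a chosen neighbour. Distinctness holds within
    one link only; links of different vertices may share more vertices than a picture suggests. *)
Record link5 (M : mpg) (v x0 x1 x2 x3 x4 : M) : Prop := Link5 {
  link5_uniq : uniq [:: x0; x1; x2; x3; x4];
  link5_third0 : third x0 v = x1;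
  link5_third1 : third x1 v = x2;
  link5_third2 : third x2 v = x3;
  link5_third3 : third x3 v = x4;
  link5_third4 : third x4 v = x0;
  link5_adj : forall w, adj v w = (w \in [:: x0; x1; x2; x3; x4])
}.

Lemma link5_rot (M : mpg) (v x0 x1 x2 x3 x4 : M) :
  link5 v x0 x1 x2 x3 x4 -> link5 v x1 x2 x3 x4 x0.
Proof.
case=> U ? ? ? ? ? A; split=> // [|w]; first by rewrite -(rot_uniq 1) in U.
by rewrite A -(mem_rot 1 [:: x0; _; _; _; _]).
Qed.

(** The last neighbour is written [third v u], the predecessor of [u] in the rotation, because this
    is how the vertices of a diamond are given. *)
Lemma degree5_link (M : mpg) (v u : M) (f := (@third M)^~ v) :
  degree v = 5 -> adj u v ->
  link5 v u (f u) (f (f u)) (f (f (f u))) (third v u).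
Proof.
move=> d5 uv.
have it n : adj (iter n f u) v.
  by elim: n => //= n; rewrite [in X in _ -> X]adj_sym; apply: third_adj.
have mem w : fconnect f u w = adj v w.
  apply/idP/idP => [/iter_findex <-|]; first by rewrite adj_sym it.
  by rewrite adj_sym; apply: third_link.
have o5 : fingraph.order f u = 5.
  by rewrite -d5; apply: eq_card => w; rewrite !inE mem.
have f5 : iter 5 f u = u.
  rewrite -{1}o5; apply/(orbitPcycle 2 4); rewrite -topredE /=.
  by apply: third_link => //; apply: (it 1).
have -> : third v u = f (f (f (f u))).
  by rewrite -{1}f5 /= third_third //; apply: (it 4).
split=> //.
- by rewrite -[uniq _]/(uniq (traject f u 5)) -o5; apply: orbit_uniq.
- by move=> w; rewrite -[_ \in _]/(w \in traject f u 5) -o5 -mem fconnect_orbit.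
Qed.

(** * Contraction of an edge at a vertex of degree 5 *)

Section Contraction.
Variables (M : mpg) (u m0 m1 m2 m3 m4 : M).
Local Notation t := (@third M).
Hypothesis link_u : link5 u m0 m1 m2 m3 m4.
Hypotheses (n02 : ~~ adj m0 m2) (n03 : ~~ adj m0 m3).

Let t0 := link5_third0 link_u.
Let t1 := link5_third1 link_u.
Let t2 := link5_third2 link_u.
Let t3 := link5_third3 link_u.
Let t4 := link5_third4 link_u.
Let adj_u := link5_adj link_u.
Let m_uniq := link5_uniq link_u.

(** Merging [u] into [m0] joins [m0] to all neighbours of [u]. As [m1] and [m4] are adjacent to [m0]
    already, only these two edges are new, and [n02], [n03] keep the graph simple. *)
Let chord (x y : M) := (x == m0) && ((y == m2) || (y == m3)).

Let e : rel M :=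
  [rel x y | [&& x != u, y != u & [|| adj x y, chord x y | chord y x]]].

(* The faces around [u] are the triangles [m_i], [u], [m_(i+1)]; contracting
   the edge from [u] to [m0] replaces them by the three triangles [m0],
   [m_(i+1)], [m_i] for i = 1, 2, 3. *)
Let s (x y : M) : M :=
  if y == m0 then
    if x == m1 then m2 else if x == m2 then m3 else if x == m3 then m4
    else t x y
  else if x == m0 then
    if y == m2 then m1 else if y == m3 then m2 else if y == m4 then m3
    else t x y
  else if t x y == u then m0 else t x y.

Let mu i : i \in [:: m0; m1; m2; m3; m4] -> i != u.
Proof. by rewrite -adj_u; apply: contraTneq => ->; rewrite adj_irr. Qed.

Let nE :
  (((m0 == m1) = false) * ((m0 == m2) = false) * ((m0 == m3) = false) * ((m0 == m4) = false) *
   ((m1 == m2) = false) * ((m1 == m3) = false) * ((m1 == m4) = false) * ((m2 == m3) = false) *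
   ((m2 == m4) = false) * ((m3 == m4) = false) * ((m0 == u) = false) * ((m1 == u) = false) *
   ((m2 == u) = false) * ((m3 == u) = false) * ((m4 == u) = false))%type.
Proof.
move: m_uniq; rewrite /= !inE !negb_or -!andbA.
case/and5P=> a b c d /and5P[f g h i /and3P[j k _]].
by do !split; apply: negbTE => //; apply: mu; rewrite !inE eqxx ?orbT.
Qed.

Let nE' :
  (((m1 == m0) = false) * ((m2 == m0) = false) * ((m3 == m0) = false) * ((m4 == m0) = false) *
   ((m2 == m1) = false) * ((m3 == m1) = false) * ((m4 == m1) = false) * ((m3 == m2) = false) *
   ((m4 == m2) = false) * ((m4 == m3) = false) * ((u == m0) = false) * ((u == m1) = false) *
   ((u == m2) = false) * ((u == m3) = false) * ((u == m4) = false))%type.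
Proof. by do !split; rewrite eq_sym nE. Qed.

Let um : (adj u m0 * adj u m1 * adj u m2 * adj u m3 * adj u m4)%type.
Proof. by do !split; rewrite adj_u !inE eqxx ?orbT. Qed.

Let mu' : (adj m0 u * adj m1 u * adj m2 u * adj m3 u * adj m4 u)%type.
Proof. by do !split; rewrite adj_sym um. Qed.

Let tu : ((t u m1 = m0) * (t u m2 = m1) * (t u m3 = m2) * (t u m4 = m3) *
          (t u m0 = m4))%type.
Proof.
by do !split; rewrite -?[in t u m1]t0 -?[in t u m2]t1 -?[in t u m3]t2 -?[in t u m4]t3
  -?[in t u m0]t4 third_third // mu'.
Qed.

Let tm : ((t m1 m0 = u) * (t m2 m1 = u) * (t m3 m2 = u) * (t m4 m3 = u) *
          (t m0 m4 = u))%type.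
Proof.
by split; [split; [split; [split|]|]|];
  [rewrite -tu.1.1.1.1|rewrite -tu.1.1.1.2|rewrite -tu.1.1.2
  |rewrite -tu.1.2|rewrite -tu.2]; rewrite third_third // um.
Qed.

Let madj : (adj m1 m0 * adj m2 m1 * adj m3 m2 * adj m4 m3 * adj m0 m4)%type.
Proof.
have h x : adj u x -> adj x (t u x) by apply: third_adj.
by do !split; [have := h m1|have := h m2|have := h m3|have := h m4|have := h m0];
  rewrite tu um => /(_ isT).
Qed.

Let madj' : (adj m0 m1 * adj m1 m2 * adj m2 m3 * adj m3 m4 * adj m4 m0)%type.
Proof. by do !split; rewrite adj_sym madj. Qed.

Let n20 : adj m2 m0 = false. Proof. by rewrite adj_sym (negPf n02). Qed.
Let n30 : adj m3 m0 = false. Proof. by rewrite adj_sym (negPf n03). Qed.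

Let chordE : ((chord m0 m2) * (chord m0 m3))%type.
Proof. by rewrite /chord !eqxx orbT. Qed.

(** The five edges opposite to [u]. The last two, those at [m0], belong to the faces that the
    contraction collapses; the other three receive [m0] as third vertex. *)
Let tE_u x y : adj x y -> t x y = u ->
  [\/ x = m2 /\ y = m1, x = m3 /\ y = m2 | x = m4 /\ y = m3] \/
  (x = m1 /\ y = m0 \/ x = m0 /\ y = m4).
Proof.
move=> h tu0; have hy : adj u y by rewrite -tu0 adj_sym third_adj.
have xE : t y u = x by rewrite -tu0 third_third.
rewrite -xE; move: hy; rewrite adj_u !inE.
case/or4P=> [|||/orP[]] /eqP ->; rewrite ?t0 ?t1 ?t2 ?t3 ?t4.
- by right; left.
- by left; constructor 1.
- by left; constructor 2.
- by left; constructor 3.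
- by right; right.
Qed.

Let e_adj x y : x != u -> y != u -> adj x y -> e x y.
Proof. by move=> xu yu h; rewrite /e /= xu yu h. Qed.

Let e_sym : symmetric e.
Proof. by move=> x y; rewrite /e /= andbCA adj_sym [chord x y || _]orbC. Qed.

Let e_chord2 : e m0 m2. Proof. by rewrite /e /= !nE !chordE orbT. Qed.
Let e_chord3 : e m0 m3. Proof. by rewrite /e /= !nE !chordE orbT. Qed.

Let eP x y : e x y ->
  [\/ [/\ x != u, y != u & adj x y], x = m0 /\ (y = m2 \/ y = m3)
    | y = m0 /\ (x = m2 \/ x = m3)].
Proof.
case/and3P=> xu yu /or3P[h|/andP[/eqP-> /orP[]/eqP->]|/andP[/eqP-> /orP[]/eqP->]].
- by constructor 1.
- by constructor 2; split=> //; left.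
- by constructor 2; split=> //; right.
- by constructor 3; split=> //; left.
- by constructor 3; split=> //; right.
Qed.

Let s_mm :
  ((s m1 m0 = m2) * (s m2 m0 = m3) * (s m3 m0 = m4) * (s m0 m2 = m1) *
  (s m0 m3 = m2) * (s m0 m4 = m3) * (s m2 m1 = m0) * (s m3 m2 = m0) *
  (s m4 m3 = m0))%type.
Proof. by do !split; rewrite /s !(eqxx, nE, nE', tm). Qed.

Let s_other x y : x != u -> y != u -> adj x y -> t x y != u -> s x y = t x y.
Proof.
move=> xu yu h tn; rewrite /s (negPf tn).
case: eqP => [y0|_].
  case: eqP => [x1|_]; first by rewrite x1 y0 tm eqxx in tn.
  case: eqP => [x2|_]; first by rewrite x2 y0 n20 in h.
  by case: eqP => [x3|_] //; rewrite x3 y0 n30 in h.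
case: eqP => [x0|_] //.
case: eqP => [y2|_]; first by rewrite x0 y2 (negPf n02) in h.
case: eqP => [y3|_]; first by rewrite x0 y3 (negPf n03) in h.
by case: eqP => [y4|_] //; rewrite x0 y4 tm eqxx in tn.
Qed.

Let s_spec x y : e x y -> e y (s x y) /\ s y (s x y) = x.
Proof.
have E := (eqxx, nE, nE').
case/eP=> [[xu yu h]|[-> [->|->]]|[-> [->|->]]].
- have [tx|tx] := eqVneq (t x y) u; last first.
    rewrite s_other //; split; first by apply: e_adj => //; apply: third_adj.
    by rewrite s_other // ?third_third // third_adj.
  case: (tE_u h tx) => [[]|[]] [-> ->]; rewrite !s_mm; split=> //.
  + by rewrite e_adj // ?E ?madj.
  + by rewrite e_sym.
  + by rewrite e_sym.
  + by rewrite e_adj // ?E ?madj.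
- by rewrite !s_mm; split=> //; apply: e_adj; rewrite ?E ?madj ?madj'.
- by rewrite !s_mm; split=> //; apply: e_adj; rewrite ?E ?madj ?madj'.
- by rewrite !s_mm.
- by rewrite !s_mm; split=> //; apply: e_adj; rewrite ?E ?madj ?madj'.
Qed.

(** The new rotation at [v] follows the old one with [u] renamed [w]. At [m0] the entry [u] expands
    into [m2], [m3]; taking the later one for [w], the step from [m1] becomes two steps. Elsewhere
    [u] becomes [m0], and at [m1] and [m4], where [u] and [m0] are consecutive, one step
    disappears. *)
Let s_hom (v w : M) (phi := fun y => if y == u then w else y) :
  v != u ->
  (v = m0 -> w = m3) -> (v != m0 -> w = m0) ->
  forall x y, adj x v -> adj y v -> fconnect (s^~ v) (phi x) (phi y).
Proof.
move=> vu w3 w0 x y xv yv.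
apply: (fconnect_hom (f := t^~ v) (h := phi) (A := [pred y | adj y v])) => //;
  last exact: third_link.
  by move=> z /= h; rewrite adj_sym third_adj.
move=> {xv yv} z /= zv; rewrite /phi.
have [v0|v0] := eqVneq v m0.
  move: w3; rewrite v0 => /(_ erefl) ->; rewrite v0 in zv.
  have step i j : s i m0 = j -> fconnect (s^~ m0) i j.
    by move=> <-; apply: (fconnect1 (s^~ m0)).
  case: eqP => [->|/eqP zu]; first by rewrite tu nE; apply: step; rewrite s_mm.
  have [tz|tz] := eqVneq (t z m0) u.
    rewrite -(third_third zv) tz t0.
    by apply: (connect_trans (step m1 m2 _) (step m2 m3 _)); rewrite s_mm.
  by apply: step; rewrite s_other ?nE.
rewrite (w0 v0).
have step i j : s i v = j -> fconnect (s^~ v) i j.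
  by move=> <-; apply: (fconnect1 (s^~ v)).
case: eqP => [zu|/eqP zu].
  have: adj u v by rewrite -zu.
  rewrite adj_u !inE (negPf v0) /= zu => /or4P[] /eqP E; rewrite E tu nE ?connect0 // -E.
  - by apply: step; rewrite E s_mm.
  - by apply: step; rewrite E s_mm.
  - by apply: step; rewrite E s_mm.
have [tz|tz] := eqVneq (t z v) u; last by apply: step; rewrite s_other.
have [z0|z0] := eqVneq z m0.
  by rewrite z0 connect0.
apply: step; rewrite /s (negPf v0) (negPf z0) tz eqxx //.
Qed.

Let s_link v x y : e x v -> e y v -> fconnect (s^~ v) x y.
Proof.
move=> ex ey; have vu : v != u by case/and3P: ex.
pose w := if v == m0 then m3 else m0.
have hom := @s_hom v w vu _ _ _ _.
have {}hom x' y' : adj x' v -> adj y' v -> fconnect (s^~ v)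
    (if x' == u then w else x') (if y' == u then w else y').
  by apply: hom; rewrite /w; [move=> ->; rewrite eqxx | move/negPf->].
have [v0|v0] := eqVneq v m0; last first.
  have lift z : e z v -> exists2 z', adj z' v & z = if z' == u then w else z'.
    case/eP=> [[zu _ h]|[-> v23]|[v00 _]]; last by rewrite v00 eqxx in v0.
      by exists z => //; rewrite (negPf zu).
    by exists u; rewrite ?eqxx /w ?(negPf v0) //; case: v23 => ->; rewrite um.
  have [[x' hx ->] [y' hy ->]] := (lift x ex, lift y ey).
  exact: hom.
have wE : w = m3 by rewrite /w v0 eqxx.
have c23 : fconnect (s^~ v) m2 m3.
  by apply: connect1; rewrite /= v0 s_mm.
(* Renaming misses [m2] at [m0]. It is reached from [m3] by turning all the way round to [m1], whose
   successor it is. *)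
have c32 : fconnect (s^~ v) m3 m2.
  apply: (@connect_trans _ _ m1).
    by have := hom u m1; rewrite eqxx nE wE v0 um madj; apply.
  by apply: connect1; rewrite /= v0 s_mm.
have both z : e z v -> fconnect (s^~ v) z m3 /\ fconnect (s^~ v) m3 z.
  case/eP=> [[zu _ h]|[_ v23]|[_ [->|->]]]; rewrite ?connect0 //.
    have := hom u z; have := hom z u; rewrite eqxx (negPf zu) wE v0 um -v0 h.
    by move=> /(_ isT isT) ? /(_ isT isT).
  have : (m0 == m2) || (m0 == m3) by rewrite -v0; case: v23 => <-; rewrite eqxx ?orbT.
  by rewrite !nE.
have [[xm _] [_ my]] := (both x ex, both y ey).
exact: connect_trans xm my.
Qed.

Let e_connected x y : x != u -> y != u -> connect e x y.
Proof.
move=> xu yu; pose phi z := if z == u then m0 else z.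
have -> : x = phi x by rewrite /phi (negPf xu).
have -> : y = phi y by rewrite /phi (negPf yu).
have c0 z : adj u z -> connect e m0 z.
  rewrite adj_u !inE => /or4P[|||/orP[]] /eqP ->; rewrite ?connect0 //;
  apply: connect1 => //; apply: e_adj; rewrite ?nE ?nE' ?madj ?madj' //.
have es : connect_sym e by apply: sym_connect_sym.
have /connectP[p] := mpg_connected x y.
elim: p x {xu} => [|z p IH] x /=; first by move=> _ ->; apply: connect0.
case/andP=> xz /IH h /h; apply: connect_trans.
rewrite /phi; case: eqP => [xE|/eqP xu]; case: eqP => [zE|/eqP zu] //.
- by apply: c0; rewrite -xE.
- by rewrite es; apply: c0; rewrite -zE adj_sym.
- by apply: connect1; apply: e_adj.
Qed.

(** Ten ordered pairs at [u] disappear and the two chords bring four, a net loss of 6, as one vertex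
    fewer requires. *)
Let e_card : #|[set p : M * M | e p.1 p.2]| + 12 = 6 * #|[pred x | x != u]|.
Proof.
have := card_darts M; have := cardC1 u.
have -> : #|predC1 u| = #|[pred x | x != u]| by apply: eq_card.
pose N := [set p : M * M | [&& p.1 != u, p.2 != u & adj p.1 p.2]].
pose nb := [set w | adj u w].
have nb5 : #|nb| = 5.
  by rewrite -[RHS](card_uniqP m_uniq); apply: eq_card => w; rewrite inE adj_u.
pose L := setX [set u] nb :|: setX nb [set u].
have cL : #|L| = 10.
  rewrite cardsU !cardsX cards1 nb5 (_ : _ :&: _ = set0) ?cards0 //.
  apply/setP => -[x y]; rewrite !inE /=; apply/negbTE/negP.
  by case/andP=> /andP[/eqP -> _] /andP[]; rewrite adj_irr.
pose K := [set p in [:: (m0, m2); (m0, m3); (m2, m0); (m3, m0)]].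
have cK : #|K| = 4.
  by rewrite cardsE; apply/card_uniqP; rewrite /= !inE !xpair_eqE !(nE, nE', andbF).
have -> : #|[set p : M * M | adj p.1 p.2]| = 10 + #|N|.
  rewrite -(cardsID L) -cL; congr (_ + _).
    congr #|pred_of_set _|; apply/setIidPr/subsetP => -[x y]; rewrite !inE /=.
    by case/orP=> /andP[]; [move=> /eqP -> | move=> + /eqP ->; rewrite adj_sym].
  apply: eq_card => -[x y]; rewrite !inE /= negb_or !negb_and.
  have [->|xu] := eqVneq x u; first by rewrite /= adj_irr; case: (adj u y).
  have [->|yu] := eqVneq y u; last by rewrite /= orbT.
  by rewrite /= orbF adj_sym andNb.
have -> : #|[set p : M * M | e p.1 p.2]| = 4 + #|N|.
  rewrite -(cardsID K) -cK; congr (_ + _).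
    congr #|pred_of_set _|; apply/setIidPr/subsetP => -[x y].
    rewrite /K !in_set !in_cons in_nil orbF !xpair_eqE.
    by case/or4P=> /andP[/eqP-> /eqP->]; rewrite // e_sym.
  apply: eq_card => -[x y]; rewrite !inE !xpair_eqE /= /e /= /chord.
  have [h|h] := boolP (adj x y); last first.
    by case: (x == u); case: (y == u); case: (x == m0); case: (y == m0);
      case: (x == m2); case: (y == m2); case: (x == m3); case: (y == m3).
  rewrite /= (_ : [|| _, _, _ | _] = false) //.
  apply/negbTE; move: h; apply: contraL.
  by case/or4P=> /andP[/eqP-> /eqP->]; rewrite ?n20 ?n30.
move: #|N| #|M| #|[pred x | _]| => a b c ->.
lia.
Qed.

Lemma contract_degree5 :
  exists M' : mpg, #|M'| < #|M| /\
    forall k, colorable M' k.+1 ->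
      exists c : M -> 'I_k.+1,
        forall x y, x != u -> y != u -> adj x y -> c x != c y.
Proof.
have e_irr : irreflexive e.
  move=> x; rewrite /e /= adj_irr orbb /chord.
  by case: (x =P m0) => [->|]; rewrite ?nE /= ?andbF.
have [||||||||M' [cM' col]] := @build_mpg M [pred x | x != u] e s.
- exact: e_sym.
- exact: e_irr.
- by move=> x y /and3P[].
- by move=> x y /s_spec[].
- by move=> x y /s_spec[].
- by move=> v x y; apply: s_link.
- by move=> x y; apply: e_connected.
- exact: e_card.
exists M'; split.
  rewrite cM' (_ : #|_| = #|predC1 u|); last by apply: eq_card.
  by rewrite cardC1 prednK //; apply/card_gt0P; exists u.
move=> k /col[c hc]; exists c => x y xu yu h.
by apply/hc/e_adj.
Qed.

End Contraction.

(** * The Kempe game on colorings of a hexagon *)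

(* Colors are elements of F_2^2: adding a nonzero [g] is the Kempe switch for
   the pairing of the four colors into cosets of {0, g}. *)
Definition color := (bool * bool)%type.
Definition addc (x y : color) : color := (x.1 (+) y.1, x.2 (+) y.2).
Definition colors : seq color :=
  [:: (false, false); (false, true); (true, false); (true, true)].
Local Notation c0 := (false, false).
Local Notation cnth := (nth (false, false)).

(* Positions 0, ..., 5 on the hexagon: of the diamond with common edge [a b],
   [a] sees 0 and 1, [c] sees 1, 2 and 3, [b] sees 3 and 4, [d] sees 4, 5 and
   0. *)
Definition extends (x : seq color) : bool :=
  has (fun a => has (fun b => has (fun c => has (fun d =>
    [&& uniq [:: a; b; c], uniq [:: a; b; d],
        a \notin [:: cnth x 0; cnth x 1], b \notin [:: cnth x 3; cnth x 4],
        c \notin [:: cnth x 1; cnth x 2; cnth x 3]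
      & d \notin [:: cnth x 4; cnth x 5; cnth x 0]])
    colors) colors) colors) colors.

Definition ring_proper (x : seq color) : bool :=
  all (fun i => cnth x i != cnth x (i.+1 %% 6)) (iota 0 6).

Fixpoint words (T : Type) (s : seq T) (n : nat) : seq (seq T) :=
  if n is m.+1 then [seq y :: w | y <- s, w <- words s m] else [:: [::]].

Definition ring_colorings : seq (seq color) :=
  [seq x <- [seq c0 :: w | w <- words colors 5] | ring_proper x].

(* A partition of the positions into Kempe chains is encoded by labelling each
   position with the least one in its chain. *)
Fixpoint labelings (n : nat) : seq (seq nat) :=
  if n is m.+1 then [seq rcons l k | l <- labelings m, k <- iota 0 n]
  else [:: [::]].

Definition noncrossing (l : seq nat) : bool :=
  all (fun i => nth 0 l (nth 0 l i) == nth 0 l i) (iota 0 6) &&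
  all (fun m => all (fun k => all (fun j => all (fun i =>
      (nth 0 l i == nth 0 l k) && (nth 0 l j == nth 0 l m) ==>
        (nth 0 l i == nth 0 l j))
    (iota 0 j)) (iota 0 k)) (iota 0 m)) (iota 0 6).

(** What the ring reveals of the chains: consecutive positions are adjacent, hence share a chain if
    their colors differ by [g], and colors within a chain differ by 0 or [g]. *)
Definition compatible (x : seq color) (g : color) (l : seq nat) : bool :=
  all (fun i =>
    ((addc (cnth x i) (cnth x (i.+1 %% 6)) == g) ==>
       (nth 0 l i == nth 0 l (i.+1 %% 6))) &&
    all (fun j => (nth 0 l i == nth 0 l j) ==>
       (addc (cnth x i) (cnth x j) \in [:: c0; g])) (iota 0 6)) (iota 0 6).

Definition recolor (x : seq color) (g : color) (l : seq nat) (J : bitseq) :=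
  [seq if nth false J (nth 0 l i) then addc (cnth x i) g else cnth x i
  | i <- iota 0 6].

Definition noncrossings := [seq l <- labelings 6 | noncrossing l].

(** The chain of position 0 is never switched, which keeps its color at [c0]. Nothing is lost:
    switching the complementary chains differs only by a translation of all ring colors by [g]. *)
Definition switches (l : seq nat) : seq bitseq :=
  [seq J <- [seq false :: J | J <- words [:: false; true] 5] |
     all (fun i => nth false J i ==> (nth 0 l i == i)) (iota 0 6)].

(** The actual chains depend on the unknown graph outside the diamond, so every partition that could
    arise must admit a successful set of switches. *)
Definition kempe_reducible (L : seq (seq color)) (x : seq color) (g : color) :=
  all (fun l => has (fun J => recolor x g l J \in L) (switches l))
    [seq l <- noncrossings | compatible x g l].

(* Since the game is symmetric, an entry of the plan, with colors coded by 0 to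
   3, stands for its six images under permutations of the nonzero colors. *)
Definition kempe_step (L : seq (seq color)) (p : seq nat * nat) :=
  [seq y.1 | y <- [seq ([seq cnth s i | i <- p.1], cnth s p.2)
                  | s <- [seq c0 :: s | s <- permutations (behead colors)]]
           & kempe_reducible L y.1 y.2] ++ L.

(* Representatives of the colorings that do not extend, found by exhaustive
   search, each with the pairing to use and after the colorings it reduces
   to. *)
Definition kempe_plan : seq (seq nat * nat) :=
  [:: ([:: 0; 1; 0; 1; 0; 1], 2); ([:: 0; 1; 0; 1; 0; 2], 3); ([:: 0; 1; 0; 2; 3; 1], 3);
   ([:: 0; 1; 2; 1; 0; 1], 2); ([:: 0; 1; 2; 3; 2; 3], 2); ([:: 0; 1; 0; 2; 0; 3], 3);
   ([:: 0; 1; 2; 1; 3; 1], 3); ([:: 0; 1; 0; 2; 1; 3], 1); ([:: 0; 1; 2; 0; 2; 3], 2);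
   ([:: 0; 1; 2; 0; 3; 1], 1); ([:: 0; 1; 2; 3; 1; 3], 2); ([:: 0; 1; 2; 0; 1; 3], 2);
   ([:: 0; 1; 2; 0; 3; 2], 1); ([:: 0; 1; 2; 3; 1; 2], 1); ([:: 0; 1; 2; 0; 1; 2], 1)].

Lemma all_mem_subset (T : eqType) (r L : seq T) :
  all (mem L) r -> {subset r <= L}.
Proof. by move/allP. Qed.

Lemma birkhoff_reducible :
  {subset ring_colorings
     <= foldl kempe_step [seq x <- ring_colorings | extends x] kempe_plan}.
Proof. apply: all_mem_subset. vm_compute. reflexivity. Qed.

Lemma addcC x y : addc x y = addc y x.
Proof. by rewrite /addc addbC [x.2 (+) _]addbC. Qed.
Lemma addcA x y z : addc x (addc y z) = addc (addc x y) z.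
Proof. by rewrite /addc /= !addbA. Qed.
Lemma addcc x : addc x x = c0.
Proof. by rewrite /addc !addbb. Qed.
Lemma addc0 x : addc x c0 = x.
Proof. by case: x => x y; rewrite /addc /= !addbF. Qed.
Lemma addcK x y : addc (addc x y) y = x.
Proof. by rewrite -addcA addcc addc0. Qed.
Lemma addc_inj y : injective (addc^~ y).
Proof. by move=> x z /(congr1 (addc^~ y)); rewrite !addcK. Qed.

Lemma mem_words (T : eqType) (s : seq T) (x : seq T) :
  {subset x <= s} -> x \in words s (size x).
Proof.
elim: x => //= y x IH xs; apply/allpairsP; exists (y, x); split=> //=.
  by apply: xs; rewrite mem_head.
by apply: IH => z zx; apply: xs; rewrite in_cons zx orbT.
Qed.

Lemma mem_labelings (f : nat -> nat) n :
  (forall i, i < n -> f i <= i) -> [seq f i | i <- iota 0 n] \in labelings n.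
Proof.
elim: n => // n IH le; rewrite -addn1 iotaD map_cat cats1 addn1 add0n.
apply/allpairsP; exists ([seq f i | i <- iota 0 n], f n); split=> //.
  by apply: IH => i /ltnW/le.
by rewrite mem_iota /= add0n ltnS le.
Qed.

Lemma connect_within (M : mpg) (e : rel M) (K : {set M}) u v :
  subrel e adj -> (forall z, connect e u z -> z \in K) ->
  connect e u v -> connect (within K) u v.
Proof.
move=> sub uK /connectP[s hs ->] {v}.
elim: s u hs uK => [|z s IH] u /=; first by rewrite connect0.
case/andP=> uz hs uK.
have uz' := connect1 uz.
apply: (@connect_trans _ _ z); last first.
  by apply: IH => // y zy; apply: uK; apply: connect_trans uz' zy.
by apply: connect1; rewrite /within /= !uK ?connect0 ?sub.
Qed.

(** * Kempe switches in the graph outside the hub *)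

Section Kempe.
Variables (M : mpg) (hub : {set M}) (R : nat -> M).
Hypothesis R_hub : forall i, i < 6 -> R i \notin hub.
Hypothesis R_step : forall i, i < 6 -> adj (R i) (R (i.+1 %% 6)).
(** [S] stands for one whole chain. It must separate positions [j] and [l] in all of the graph
    outside the hub and [S], whatever the colors there. *)
Hypothesis R_noncrossing : forall (S : {set M}) i j k l,
  i < j -> j < k -> k < l -> l < 6 -> [disjoint S & hub] ->
  R i \in S -> R k \in S -> R j \notin S ->
  connect (within S) (R i) (R k) ->
  connect (within (~: (S :|: hub))) (R j) (R l) -> False.

Definition proper_outside (col : M -> color) : Prop :=
  forall x y, x \notin hub -> y \notin hub -> adj x y -> col x != col y.

Definition ring_colors (col : M -> color) : seq color :=
  [seq col (R i) | i <- iota 0 6].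

(** The game is read contrapositively: if no coloring outside the hub extends, then no ring coloring
    from which the game is won can occur. *)
Definition excluded (x : seq color) : Prop :=
  forall col, proper_outside col -> ring_colors col = x -> False.

Lemma nth_ring_colors col i : i < 6 -> cnth (ring_colors col) i = col (R i).
Proof. by move=> i6; rewrite (nth_map 0) ?size_iota // nth_iota. Qed.

Section Switch.
Variables (col : M -> color) (g : color).
Hypothesis col_proper : proper_outside col.

Let kempe : rel M :=
  [rel x y | [&& x \notin hub, y \notin hub, adj x y & addc (col x) (col y) == g]].

Let kempe_adj : subrel kempe adj.
Proof. by move=> x y /and4P[]. Qed.

Let kempe_sym : connect_sym kempe.
Proof.
by apply: sym_connect_sym => x y; rewrite /kempe /= andbCA adj_sym addcC.
Qed.

Let kempe_hub u z : u \notin hub -> connect kempe u z -> z \notin hub.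
Proof.
move=> uh /connectP[s]; elim: s u uh => [|y s IH] u uh /=; first by move=> _ ->.
by case/andP=> /and4P[_ yh _ _]; apply: IH.
Qed.

Let kempe_col u z : connect kempe u z -> addc (col u) (col z) \in [:: c0; g].
Proof.
move=> /connectP[s]; elim: s u => [|y s IH] u /=.
  by move=> _ ->; rewrite addcc mem_head.
case/andP=> /and4P[_ _ _ /eqP uy] hs E; have := IH y hs E.
have -> : addc (col u) (col z) = addc g (addc (col y) (col z)).
  by rewrite -uy !addcA addcK.
rewrite !inE => /orP[] /eqP ->; first by rewrite addc0 eqxx orbT.
by rewrite addcc eqxx.
Qed.

Let lab i := find (fun j => connect kempe (R j) (R i)) (iota 0 6).

Let lab_has i : i < 6 -> has (fun j => connect kempe (R j) (R i)) (iota 0 6).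
Proof. by move=> i6; apply/hasP; exists i; rewrite ?mem_iota ?connect0. Qed.

Let lab_lt i : i < 6 -> lab i < 6.
Proof. by move/lab_has; rewrite has_find size_iota. Qed.

Let lab_connect i : i < 6 -> connect kempe (R (lab i)) (R i).
Proof.
move=> i6; have := nth_find 0 (lab_has i6).
by rewrite nth_iota ?add0n //; apply: lab_lt.
Qed.

Let lab_le i : i < 6 -> lab i <= i.
Proof.
move=> i6; rewrite leqNgt; apply/negP => h.
have := before_find 0 h; rewrite nth_iota ?add0n //.
by rewrite connect0.
Qed.

Let lab_eq i j : i < 6 -> j < 6 -> (lab i == lab j) = connect kempe (R i) (R j).
Proof.
move=> i6 j6; apply/eqP/idP => [E|ij].
  apply: connect_trans (lab_connect j6); rewrite -E kempe_sym.
  exact: lab_connect.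
apply: eq_find => k; apply/idP/idP => h; first exact: connect_trans h ij.
by apply: connect_trans h _; rewrite kempe_sym.
Qed.

Let labs := [seq lab i | i <- iota 0 6].

Let nth_labs i : i < 6 -> nth 0 labs i = lab i.
Proof. by move=> i6; rewrite (nth_map 0) ?size_iota // nth_iota. Qed.

Let labs_noncrossing : labs \in noncrossings.
Proof.
rewrite mem_filter mem_labelings ?andbT; last exact: lab_le.
apply/andP; split.
  apply/allP => i; rewrite mem_iota /= add0n => i6.
  by rewrite !nth_labs ?lab_lt // lab_eq ?lab_lt // lab_connect.
apply/allP => l; rewrite mem_iota /= => l6.
apply/allP => k; rewrite mem_iota /= => kl.
apply/allP => j; rewrite mem_iota /= => jk.
apply/allP => i; rewrite mem_iota /= => ij.
have k6 := ltn_trans kl l6; have j6 := ltn_trans jk k6; have i6 := ltn_trans ij j6.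
rewrite !nth_labs ?lab_eq //; apply/implyP => /andP[ik jl]; apply/negPn/negP => nij.
(* The chain of [R i]. The chain of [R j] is a different one, so it stays outside [S], and outside
   the hub like every chain. *)
pose S := [set z | connect kempe (R i) z].
apply: (@R_noncrossing S i j k l) => //.
- apply/pred0P => z /=; apply/negbTE/andP => -[]; rewrite inE => iz.
  by apply/negP; apply: kempe_hub iz; apply: R_hub.
- by rewrite inE connect0.
- by rewrite inE.
- by rewrite inE.
- by apply: (connect_within kempe_adj) => // z iz; rewrite inE.
apply: (connect_within kempe_adj) => // z jz; rewrite !inE negb_or.
rewrite (kempe_hub _ jz) ?R_hub // andbT; apply: contra nij => iz.
by apply: connect_trans iz _; rewrite kempe_sym.
Qed.

Let labs_compatible : compatible (ring_colors col) g labs.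
Proof.
apply/allP => i; rewrite mem_iota => /andP[_ i6]; rewrite add0n in i6.
have i6' : i.+1 %% 6 < 6 by rewrite ltn_mod.
apply/andP; split.
  rewrite !nth_labs // !nth_ring_colors // lab_eq //; apply/implyP => h.
  by apply/connect1/and4P; split; [exact: R_hub|exact: R_hub|exact: R_step|].
apply/allP => j; rewrite mem_iota /= add0n => j6.
rewrite !nth_labs // !nth_ring_colors // lab_eq //; apply/implyP.
exact: kempe_col.
Qed.

Let switched (J : bitseq) : {set M} :=
  [set z | has (fun i => nth false J (lab i) && connect kempe (R i) z) (iota 0 6)].

Let switch (J : bitseq) (z : M) : color :=
  if z \in switched J then addc (col z) g else col z.

(** An edge whose colors differ by [g] lies in one chain, so both ends switch or neither does; on
    any other edge, adding [g] at one end cannot make the colors equal. *)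
Let switch_proper J : proper_outside (switch J).
Proof.
move=> x y xh yh xy; rewrite /switch.
have [K|K] := boolP (addc (col x) (col y) == g).
  have -> : (x \in switched J) = (y \in switched J).
    have cxy : connect kempe x y by apply/connect1/and4P; split.
    rewrite !inE; apply: eq_has => i; congr (_ && _).
    by apply/idP/idP => h; apply: connect_trans h _; rewrite // kempe_sym.
  case: ifP => _; last exact: col_proper.
  by rewrite (inj_eq (@addc_inj g)) col_proper.
have nK := K; rewrite addcC in nK.
have gx u z : addc (col u) (col z) != g -> addc (col u) g != col z.
  by apply: contra => /eqP <-; rewrite addcA addcc addcC addc0.
case: ifP => _; case: ifP => _; first by rewrite (inj_eq (@addc_inj g)) col_proper.
- exact: gx.
- by rewrite eq_sym gx.
- exact: col_proper.
Qed.

Let switch_ring J : ring_colors (switch J) = recolor (ring_colors col) g labs J.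
Proof.
apply/eq_in_map => i; rewrite mem_iota /= add0n => i6.
rewrite /switch nth_ring_colors // nth_labs // inE.
congr (if _ then _ else _).
apply/hasP/idP => [[j]|h]; last by exists i; rewrite ?mem_iota ?h ?connect0.
by rewrite mem_iota /= add0n => j6 /andP[h]; rewrite -lab_eq // => /eqP <-.
Qed.

Lemma kempe_reducible_excluded (L : seq (seq color)) :
  (forall x, x \in L -> excluded x) ->
  kempe_reducible L (ring_colors col) g -> False.
Proof.
move=> exL /allP/(_ labs); rewrite mem_filter labs_compatible labs_noncrossing.
case/(_ isT)/hasP => J _; rewrite -switch_ring => /exL /(_ _ (@switch_proper J)).
exact.
Qed.

End Switch.

Lemma kempe_plan_excluded (L : seq (seq color)) :
  (forall x, x \in L -> excluded x) ->
  forall x, x \in foldl kempe_step L kempe_plan -> excluded x.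
Proof.
elim: kempe_plan L => //= p plan IH L exL; apply: IH => x.
rewrite mem_cat => /orP[|]; last exact: exL.
case/mapP=> y; rewrite mem_filter => /andP[red _] -> col pc E.
by rewrite -E in red; apply: (kempe_reducible_excluded pc exL red).
Qed.

Theorem ring_extension col : proper_outside col ->
  (forall col', proper_outside col' -> ~~ extends (ring_colors col')) -> False.
Proof.
(* Translating all colors permutes them, so position 0 may be given the color [c0], as in
   [ring_colorings]. *)
move=> pc nex; pose col1 z := addc (col z) (col (R 0)).
have pc1 : proper_outside col1.
  by move=> x y xh yh xy; rewrite (inj_eq (@addc_inj _)) pc.
have ring1 : ring_colors col1 \in ring_colorings.
  rewrite mem_filter; apply/andP; split.
    apply/allP => i; rewrite mem_iota add0n => /andP[_ i6].
    by rewrite !nth_ring_colors ?ltn_mod // pc1 ?R_hub ?ltn_mod // R_step.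
  have -> : ring_colors col1 = c0 :: [seq col1 (R i) | i <- iota 1 5].
    by rewrite /ring_colors /= {1}/col1 addcc.
  apply: map_f; have := @mem_words _ colors [seq col1 (R i) | i <- iota 1 5].
  rewrite size_map size_iota; apply.
  by move=> -[[] []].
have excluded0 x : x \in [seq x <- ring_colorings | extends x] -> excluded x.
  rewrite mem_filter => /andP[ext _] col' pc' E.
  by have := nex _ pc'; rewrite E ext.
have := kempe_plan_excluded excluded0 (birkhoff_reducible ring1).
by move/(_ col1 pc1 erefl).
Qed.

End Kempe.

(** * The diamond *)

Lemma adj_neq (G : sgraph) (x y : G) : adj x y -> x != y.
Proof. by apply: contraTneq => ->; rewrite adj_irr. Qed.

Section BirkhoffDiamond.
Variables (M : mpg) (a b c d q p v t s w : M).
Hypotheses (La : link5 a b d q p c) (Lb : link5 b a c t s d).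
Hypotheses (Lc : link5 c b a p v t) (Ld : link5 d a b s w q).

Let hub : {set M} := [set a; b; c; d].
Let ring : seq M := [:: q; p; v; t; s; w].
Let inner : seq M := [:: a; a; c; b; b; d].

Let Ea := link5_adj La.
Let Eb := link5_adj Lb.
Let Ec := link5_adj Lc.
Let Ed := link5_adj Ld.

Let A_a : ((adj a b) * (adj a d) * (adj a q) * (adj a p) * (adj a c))%type.
Proof. by rewrite !Ea !inE !eqxx !orbT. Qed.
Let A_b : ((adj b a) * (adj b c) * (adj b t) * (adj b s) * (adj b d))%type.
Proof. by rewrite !Eb !inE !eqxx !orbT. Qed.
Let A_c : ((adj c b) * (adj c a) * (adj c p) * (adj c v) * (adj c t))%type.
Proof. by rewrite !Ec !inE !eqxx !orbT. Qed.
Let A_d : ((adj d a) * (adj d b) * (adj d s) * (adj d w) * (adj d q))%type.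
Proof. by rewrite !Ed !inE !eqxx !orbT. Qed.

Let Ua : [&& b != d, b != q, b != p, b != c, d != q, d != p, d != c, q != p,
  q != c & p != c].
Proof.
by have := link5_uniq La; rewrite /= !inE !negb_or -!andbA andbT.
Qed.
Let Ub : [&& a != c, a != t, a != s, a != d, c != t, c != s, c != d, t != s,
  t != d & s != d].
Proof.
by have := link5_uniq Lb; rewrite /= !inE !negb_or -!andbA andbT.
Qed.
Let Uc : [&& b != a, b != p, b != v, b != t, a != p, a != v, a != t, p != v,
  p != t & v != t].
Proof.
by have := link5_uniq Lc; rewrite /= !inE !negb_or -!andbA andbT.
Qed.
Let Ud : [&& a != b, a != s, a != w, a != q, b != s, b != w, b != q, s != w,
  s != q & w != q].
Proof.
by have := link5_uniq Ld; rewrite /= !inE !negb_or -!andbA andbT.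
Qed.

Let nE :
  (((b == d) = false) * ((b == q) = false) * ((b == p) = false) * ((b == c) = false) *
   ((d == q) = false) * ((d == p) = false) * ((d == c) = false) * ((q == p) = false) *
   ((q == c) = false) * ((p == c) = false) * ((a == c) = false) * ((a == t) = false) *
   ((a == s) = false) * ((a == d) = false) * ((c == t) = false) * ((c == s) = false) *
   ((t == s) = false) * ((t == d) = false) * ((a == b) = false) * ((b == v) = false) *
   ((b == t) = false) * ((a == p) = false) * ((a == v) = false) * ((a == q) = false) *
   ((p == v) = false) * ((p == t) = false) * ((v == t) = false) * ((a == w) = false) *
   ((b == s) = false) * ((b == w) = false) * ((s == w) = false) * ((s == d) = false) *
   ((s == q) = false) * ((w == q) = false))%type.
Proof.
case/and5P: Ua => ? ? ? ? /and5P[? ? ? ? /andP[? ?]].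
case/and5P: Ub => ? ? ? ? /and5P[? ? ? ? /andP[? ?]].
case/and5P: Uc => ? ? ? ? /and5P[? ? ? ? /andP[? ?]].
case/and5P: Ud => ? ? ? ? /and5P[? ? ? ? /andP[? ?]].
by do !split; apply: negbTE.
Qed.

Let nE' :
  (((d == b) = false) * ((q == b) = false) * ((p == b) = false) * ((c == b) = false) *
   ((q == d) = false) * ((p == d) = false) * ((c == d) = false) * ((p == q) = false) *
   ((c == q) = false) * ((c == p) = false) * ((c == a) = false) * ((t == a) = false) *
   ((s == a) = false) * ((d == a) = false) * ((t == c) = false) * ((s == c) = false) *
   ((s == t) = false) * ((d == t) = false) * ((b == a) = false) * ((v == b) = false) *
   ((t == b) = false) * ((p == a) = false) * ((v == a) = false) * ((q == a) = false) *
   ((v == p) = false) * ((t == p) = false) * ((t == v) = false) * ((w == a) = false) *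
   ((s == b) = false) * ((w == b) = false) * ((w == s) = false) * ((d == s) = false) *
   ((q == s) = false) * ((q == w) = false))%type.
Proof. by do !split; rewrite eq_sym nE. Qed.

(** No single link separates [v] from [d]. If they were equal, [c] would be a neighbour of [d], and
    only [w = c] is possible; the face [c t d] then makes both [t] and [s] precede [c] in the
    rotation at [d]. *)
Let vd : (v == d) = false.
Proof.
apply/eqP => vE; have cd : adj d c by rewrite adj_sym -vE A_c.
have wE : w = c.
  by move: cd; rewrite Ed !inE !(nE, nE') orbF => /eqP.
have tct : third c t = d.
  by rewrite -(link5_third3 Lc) vE third_third // adj_sym -vE A_c.
have td : adj t d by rewrite -tct third_adj ?A_c.
have ttd : third t d = third s d.
  by rewrite (link5_third2 Ld) wE -tct third_third ?A_c.
have : t = s by rewrite -(third_third td) ttd third_third // adj_sym A_d.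
by apply/eqP; rewrite nE.
Qed.

Let wc : (w == c) = false.
Proof.
apply/eqP => wE; have : adj c d by rewrite adj_sym -wE A_d.
by rewrite Ec !inE ![d == _]eq_sym vd !(nE, nE').
Qed.

Let hub_link x : x \in hub -> connect (within hub) a x /\ connect (within hub) x a.
Proof.
have aH : a \in hub by rewrite !inE eqxx.
move=> xH; have [->|ax] := eqVneq x a; first by rewrite connect0.
have ax' : adj a x.
  by move: xH ax; rewrite !inE -!orbA => /or4P[] /eqP ->; rewrite ?A_a // eqxx.
by split; apply: connect1; rewrite /within /= aH xH // adj_sym.
Qed.

Let inner_hub i : i < 6 -> nth a inner i \in hub.
Proof. by case: i => [|[|[|[|[|[|]]]]]] //= _; rewrite !inE eqxx ?orbT. Qed.

Let vc : (v == c) = false.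
Proof. by apply: negbTE; rewrite adj_neq // adj_sym A_c. Qed.

Let wd : (w == d) = false.
Proof. by apply: negbTE; rewrite adj_neq // adj_sym A_d. Qed.

Lemma ring_hub i : i < 6 -> nth a ring i \notin hub.
Proof.
by case: i => [|[|[|[|[|[|]]]]]] //= _; rewrite !inE ?(vd, vc, wc, wd) !(nE, nE').
Qed.

Let spoke i : i < 6 -> adj (nth a inner i) (nth a ring i).
Proof.
by case: i => [|[|[|[|[|[|]]]]]] //= _; rewrite ?A_a ?A_b ?A_c ?A_d.
Qed.

Let spoke_inj i j : i < 6 -> j < 6 ->
  (nth a inner i, nth a ring i) = (nth a inner j, nth a ring j) -> i = j.
Proof.
have E := (nE, nE').
case: i => [|[|[|[|[|[|]]]]]] //= _; case: j => [|[|[|[|[|[|]]]]]] //= _ /eqP;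
  by rewrite xpair_eqE ?(nE, nE') ?andbF.
Qed.

Lemma ring_step i : i < 6 -> adj (nth a ring i) (nth a ring (i.+1 %% 6)).
Proof.
have h x y z : adj y x -> third x y = z -> adj x z.
  rewrite adj_sym => xy <-; have := third_adj (third_adj xy).
  by rewrite third_third // adj_sym.
case: i => [|[|[|[|[|[|]]]]]] //= _.
- by apply: h (link5_third2 La); rewrite A_a.
- by apply: h (link5_third2 Lc); rewrite A_c.
- by apply: h (link5_third3 Lc); rewrite A_c.
- by apply: h (link5_third2 Lb); rewrite A_b.
- by apply: h (link5_third2 Ld); rewrite A_d.
- by apply: h (link5_third3 Ld); rewrite A_d.
Qed.

(* Close the chain from position i to position k through the hub: between two
   consecutive spokes the potential changes only at spokes i and k, so it
   differs at j and l, while it is constant along the other chain. *)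
Lemma ring_noncrossing (S : {set M}) i j k l :
  i < j -> j < k -> k < l -> l < 6 -> [disjoint S & hub] ->
  nth a ring i \in S -> nth a ring k \in S -> nth a ring j \notin S ->
  connect (within S) (nth a ring i) (nth a ring k) ->
  connect (within (~: (S :|: hub))) (nth a ring j) (nth a ring l) -> False.
Proof.
move=> ij jk kl l6 Sh iS kS jS cik cjl.
have k6 : k < 6 := ltn_trans kl l6.
have j6 : j < 6 := ltn_trans jk k6.
have i6 : i < 6 := ltn_trans ij j6.
pose x n (n6 : n < 6) : dart M :=
  exist _ (nth a inner n, nth a ring n) (spoke n6).
have xE n (n6 : n < 6) y z (yz : adj y z) :
    ((exist _ (y, z) yz : dart M) == x n n6) = ((y, z) == (nth a inner n, nth a ring n)).
  by [].
have cH : connect (within hub) (nth a inner i) (nth a inner k).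
  apply: (@connect_trans _ _ a).
    by case: (hub_link (inner_hub i6)).
  by case: (hub_link (inner_hub k6)).
have [|f [f_face f_cross f_away]] :=
    cut_potential Sh (inner_hub i6) iS (inner_hub k6) kS _ cH cik
      (x1 := x i i6) (x2 := x k k6).
  by apply/eqP => /(congr1 val) /spoke_inj => /(_ i6 k6) E; have := ltn_trans ij jk; rewrite E ltnn.
have {}f_cross y z : y \in hub -> z \notin hub -> adj y z ->
    f z y = f y z (+) (((y, z) == (nth a inner i, nth a ring i)) ||
                       ((y, z) == (nth a inner k, nth a ring k))).
  by move=> yH zH yz; have := f_cross (exist _ (y, z) yz) yH zH; rewrite !xE.
have cross n : n < 6 -> f (nth a ring n) (nth a inner n) =
    f (nth a inner n) (nth a ring n) (+) ((n == i) || (n == k)).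
  move=> n6; rewrite f_cross ?inner_hub ?ring_hub ?spoke //; congr (_ (+) (_ || _)).
    by apply/eqP/eqP => [/spoke_inj->|->].
  by apply/eqP/eqP => [/spoke_inj->|->].
have turn y z u : adj y z -> third y z = u -> f y z = f z u.
  by move=> yz <-; apply: f_face.
have skip y z : y \in hub -> z \notin hub -> adj y z ->
    (forall n, n < 6 -> (y, z) != (nth a inner n, nth a ring n)) -> f z y = f y z.
  move=> yH zH yz no; rewrite f_cross //.
  by rewrite (negPf (no i i6)) (negPf (no k k6)) addbF.
(* Between consecutive spokes the faces at the hub are separated by edges inside the hub or by one
   unchosen edge. Within the hub the path needs no crossing count: the faces used all lie on the
   ring side. Positions [j] to [l] do not wrap, so the step from 5 to 0 is left out. *)
have next n : n < 5 ->
    f (nth a inner n.+1) (nth a ring n.+1) = f (nth a ring n) (nth a inner n).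
  have skip3 : [/\ f p c = f c p, f t c = f c t & f s d = f d s].
    split; [apply: (skip c p (@inner_hub 2 isT) (@ring_hub 1 isT))
           |apply: (skip c t (@inner_hub 2 isT) (@ring_hub 3 isT))
           |apply: (skip d s (@inner_hub 5 isT) (@ring_hub 4 isT))];
      rewrite ?A_c ?A_d //;
      by case=> [|[|[|[|[|[|]]]]]] //= _; rewrite xpair_eqE ?(nE, nE') ?andbF.
  have [sp st ss] := skip3.
  case: n => [|[|[|[|[|]]]]] //= _.
  - by rewrite (turn _ _ _ _ (link5_third2 La)) // adj_sym A_a.
  - rewrite (turn _ _ _ _ (link5_third3 La)) 1?adj_sym ?A_a //.
    rewrite (turn _ _ _ _ (link5_third1 Lc)) ?A_a // -sp.
    by rewrite (turn _ _ _ _ (link5_third2 Lc)) // adj_sym A_c.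
  - rewrite (turn _ _ _ _ (link5_third3 Lc)) 1?adj_sym ?A_c // -st.
    rewrite (turn _ _ _ _ (link5_third4 Lc)) 1?adj_sym ?A_c //.
    by rewrite (turn _ _ _ _ (link5_third1 Lb)) // A_c.
  - by rewrite (turn _ _ _ _ (link5_third2 Lb)) // adj_sym A_b.
  - rewrite (turn _ _ _ _ (link5_third3 Lb)) 1?adj_sym ?A_b //.
    rewrite (turn _ _ _ _ (link5_third1 Ld)) ?A_b // -ss.
    by rewrite (turn _ _ _ _ (link5_third2 Ld)) // adj_sym A_d.
pose g n := f (nth a inner n) (nth a ring n).
have gS n : n < 5 -> g n.+1 = g n (+) ((n == i) || (n == k)).
  by move=> n5; rewrite /g next // cross // ltnW.
have const m e : m + e < 6 -> (forall n, m <= n < m + e -> (n != i) && (n != k)) ->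
    g (m + e) = g m.
  elim: e => [|e IH] me no; first by rewrite addn0.
  rewrite addnS in me no *.
  have /andP[/negPf ni /negPf nk] := no (m + e) ltac:(by rewrite leq_addr ltnS leqnn).
  rewrite gS // ni nk addbF IH // 1?ltnW // => n /andP[mn ne].
  by apply: no; rewrite mn ltnS ltnW.
have gjk : g k = g j.
  rewrite -(subnKC (ltnW jk)); apply: const; rewrite subnKC ?(ltnW jk) // => n /andP[jn nk].
  by rewrite (gtn_eqF (leq_trans ij jn)) (ltn_eqF nk).
have gkl : g l = g k.+1.
  rewrite -(subnKC kl); apply: const; rewrite subnKC // => n /andP[kn _].
  by rewrite (gtn_eqF kn) (gtn_eqF (ltn_trans (ltn_trans ij jk) kn)).
have gk : g k.+1 = ~~ g k by rewrite gS ?eqxx ?orbT ?addbT // (leq_trans kl).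
have away y z : adj y z -> y \in ~: (S :|: hub) -> f y z = f z y.
  by rewrite in_setC; apply: f_away.
have jK : nth a ring j \in ~: (S :|: hub).
  by rewrite in_setC in_setU negb_or jS ring_hub.
have := potential_along f_face away cjl jK (x' := nth a inner j) (y' := nth a inner l).
rewrite !(adj_sym (nth a ring _)) !spoke // => /(_ isT isT).
rewrite !cross // -!/(g _) (gtn_eqF ij) (ltn_eqF jk) (gtn_eqF kl).
rewrite (gtn_eqF (ltn_trans ij (ltn_trans jk kl))) !addbF gkl gk gjk.
by case: (g j).
Qed.

(** Noncrossing for chains reduced to a single vertex: two interleaved coincidences would be two
    crossing chains. *)
Lemma ring_coincidences i j k l :
  i < j -> j < k -> k < l -> l < 6 ->
  nth a ring i = nth a ring k -> nth a ring j = nth a ring l ->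
  nth a ring i = nth a ring j.
Proof.
move=> ij jk kl l6 ik jl; apply/eqP/negPn/negP => nij.
have k6 := ltn_trans kl l6.
apply: (@ring_noncrossing [set nth a ring i] i j k l) => //.
- by rewrite disjoints1 ik ring_hub.
- by rewrite set11.
- by rewrite -ik set11.
- by rewrite in_set1 eq_sym.
- by rewrite -ik connect0.
- by rewrite -jl connect0.
Qed.

(* Contracting an edge at [a] keeps the graph simple unless its ends have a
   third common neighbour.  A common neighbour of [a] and [b] other than [c]
   and [d] is a coincidence [p = s] or [q = t] of ring vertices; by planarity
   such a coincidence excludes those obstructing the contraction of [a q],
   respectively of [a p]. *)
Lemma contract_in_hub :
  exists M' : mpg, #|M'| < #|M| /\
    forall k, colorable M' k.+1 ->
      exists col : M -> 'I_k.+1, forall x y,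
        x \notin hub -> y \notin hub -> adj x y -> col x != col y.
Proof.
have aH x : x \notin hub -> x != a.
  by apply: contraNneq => ->; rewrite !inE eqxx.
suff [m0 [m1 [m2 [m3 [m4 [L n2 n3]]]]]] : exists m0 m1 m2 m3 m4,
    [/\ link5 a m0 m1 m2 m3 m4, ~~ adj m0 m2 & ~~ adj m0 m3].
  have [M' [cM' col]] := contract_degree5 L n2 n3.
  exists M'; split=> // k /col[g hg]; exists g => x y /aH xa /aH ya.
  exact: hg.
have qp : (q == p) = false by rewrite nE.
have [ps|ps] := eqVneq p s.
  have nqt : (q == t) = false.
    by apply: contraFF qp => /eqP qt; apply/eqP/(@ring_coincidences 0 1 3 4).
  have nqv : (q == v) = false.
    by apply: contraFF qp => /eqP qv; apply/eqP/(@ring_coincidences 0 1 2 4).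
  exists q, p, c, b, d; split; first by do 2!apply: link5_rot.
    by rewrite adj_sym Ec !inE nqt nqv ?(nE, nE').
  by rewrite adj_sym Eb !inE nqt ?(nE, nE').
have [qt|qt] := eqVneq q t.
  have npw : (p == w) = false.
    by apply: contraFF qp => /eqP pw; apply/eqP/(@ring_coincidences 0 1 3 5).
  exists p, c, b, d, q; split; first by do 3!apply: link5_rot.
    by rewrite adj_sym Eb !inE (negPf ps) ?(nE, nE').
  by rewrite adj_sym Ed !inE (negPf ps) npw ?(nE, nE').
exists b, d, q, p, c; split=> //.
  by rewrite Eb !inE (negPf qt) ?(nE, nE').
by rewrite Eb !inE (negPf ps) ?(nE, nE').
Qed.

Lemma extends_hub (col : M -> color) :
  proper_outside hub col -> extends (ring_colors (nth a ring) col) ->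
  exists col' : M -> color, forall x y, adj x y -> col' x != col' y.
Proof.
move=> pc /hasP[ca _ /hasP[cb _ /hasP[cc _ /hasP[cd _]]]].
rewrite /= !inE !negb_or !andbT => /and5P[/andP[/andP[ab ac] bc]].
move=> /andP[/andP[_ ad] bd] /andP[aq ap] /andP[bt bs].
case/andP=> /and3P[cp cv ct] /and3P[ds dw dq].
pose col' z := if z == a then ca else if z == b then cb else
  if z == c then cc else if z == d then cd else col z.
have hubE : (col' a = ca) * (col' b = cb) * (col' c = cc) * (col' d = cd).
  by rewrite /col' !eqxx !(nE, nE').
have outE z : z \notin hub -> col' z = col z.
  rewrite !inE !negb_or -!andbA /col'.
  by case/and4P=> /negPf-> /negPf-> /negPf-> /negPf->.
have ringE i : i < 6 -> col' (nth a ring i) = col (nth a ring i).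
  by move=> i6; rewrite outE ?ring_hub.
have hubN x y : x \in hub -> adj x y -> col' x != col' y.
  have rE := (ringE 0 isT, ringE 1 isT, ringE 2 isT, ringE 3 isT, ringE 4 isT, ringE 5 isT).
  rewrite /= in rE; rewrite !inE -!orbA.
  case/or4P=> /eqP->; rewrite ?Ea ?Eb ?Ec ?Ed !inE;
    by case/or4P=> [|||/orP[]] /eqP->; rewrite ?hubE ?rE // eq_sym.
exists col' => x y xy.
have [xh|xh] := boolP (x \in hub); first exact: hubN.
have [yh|yh] := boolP (y \in hub); first by rewrite eq_sym hubN // adj_sym.
by rewrite !outE // pc.
Qed.

End BirkhoffDiamond.

Lemma color_colorable (G : sgraph) (col : G -> color) :
  (forall x y, adj x y -> col x != col y) -> colorable G 4.
Proof.
move=> pc; pose f (x : color) : 'I_4 := inord (x.1.*2 + x.2).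
have f_inj : injective f.
  by move=> [[] []] [[] []] /(congr1 (@nat_of_ord 4)); rewrite /= !inordK.
by exists (fun x => f (col x)) => x y xy; rewrite (inj_eq f_inj) pc.
Qed.

(** Minimality says only that a smaller map cannot fail to be colorable. Double negations are
    enough, since the final goal is a contradiction, and the argument stays constructive. *)
Lemma birkhoff_diamond_colorable (M : mpg) (a b c d q p v t s w : M) :
  link5 a b d q p c -> link5 b a c t s d -> link5 c b a p v t ->
  link5 d a b s w q ->
  (forall M' : mpg, #|M'| < #|M| -> ~ ~ colorable M' 4) -> ~ ~ colorable M 4.
Proof.
move=> La Lb Lc Ld smaller nM.
have [M' [ltM col4]] := contract_in_hub La Lb Lc Ld.
apply: (smaller M' ltM) => /col4[g hg].
pose f (i : 'I_4) : color := (1 < i, odd i).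
have f_inj : injective f.
  by move=> [[|[|[|[|//]]]] ?] [[|[|[|[|//]]]] ?] //= _; apply: val_inj.
apply: (@ring_extension M [set a; b; c; d] (nth a [:: q; p; v; t; s; w])
  _ _ _ (fun x => f (g x))).
- exact: (ring_hub La Lb Lc Ld).
- exact: (ring_step La Lb Lc Ld).
- exact: (ring_noncrossing La Lb Lc Ld).
- by move=> x y xh yh xy; rewrite (inj_eq f_inj) hg.
move=> col pc; apply/negP => /(extends_hub La Lb Lc Ld pc)[col' pc'].
exact/nM/(color_colorable pc').
Qed.

Theorem theorem19p3 (EP : mpg) (hEP : extremum_non4colorable EP)
    (a b c d : EP) (hd : diamond a b c d) :
  ~ [/\ degree a = 5, degree b = 5, degree c = 5 & degree d = 5].
Proof.
case: hd => x [_ aE bE cE dE] [da db dc dd].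
have ab : adj a b by rewrite aE bE; apply: (valP x).
have ba : adj b a by rewrite adj_sym.
have {}cE : third a b = c by rewrite aE bE thirdE.
have {}dE : third b a = d.
  by rewrite dE aE bE -[head x]/(tail (rev x)) -[tail x in LHS]/(head (rev x)) thirdE.
have La := degree5_link da ba; have Lb := degree5_link db ab.
rewrite cE dE in La Lb.
have ca : third b c = a by rewrite -cE third_third.
have db' : third a d = b by rewrite -dE third_third.
have bc : adj b c by rewrite -cE third_adj.
have ad : adj a d by rewrite -dE third_adj.
have Lc := degree5_link dc bc; have Ld := degree5_link dd ad.
have pa : adj (third (third d a) a) a.
  by rewrite adj_sym (link5_adj La) !inE eqxx !orbT.
have sb : adj (third (third c b) b) b.
  by rewrite adj_sym (link5_adj Lb) !inE eqxx !orbT.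
(* The ring vertex next to both [a] and [c] has a name from each of their links; this equation and
   the next one for [b] and [d] make the four links speak of the same vertices. *)
have ac : third a c = third (third d a) a.
  by rewrite -[in LHS](link5_third3 La) third_third.
have bd : third b d = third (third c b) b.
  by rewrite -[in LHS](link5_third3 Lb) third_third.
rewrite ca ac in Lc; rewrite db' bd in Ld.
apply: (birkhoff_diamond_colorable La Lb Lc Ld _ hEP.1) => M' lt nM'.
by have := hEP.2 M' nM'; rewrite leqNgt lt.
Qed.
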